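(* There exist absolute constants $C_1$ and $C_2$ (depending neither on $n$ nor on the triangular array, the boundary or the sequence $r_n$) such that the following holds. Let $\{X_{i,n}\}_{1\le i\le n,\ n\ge1}$ be a triangular array, $\{g_{k,n}\}_{1\le k\le n,\ n\ge 1}$ deterministic real numbers and $\{r_n\}$ a deterministic sequence as in the context; in particular $|X_{i,n}|\le r_n$ for all $1\le i\le n$ with $r_n\to0$, and $g_n^*:=\max_{1\le k\le n}|g_{k,n}|\to0$ as $n\to\infty$. Then for every $n\ge1$: (1) $$\mathbf{P}(T_n>n)\ge\sqrt{\frac{2}{\pi}}\,E_n\big(1-C_1(r_n+g_n^* )^{2/3}\big).$$ (2) $$\mathbf{P}(T_n>n)\le\sqrt{\frac{2}{\pi}}\,E_n\big(1+C_2(r_n+g_n^* )^{2/3}\big)\qquad\text{if } r_n+g_n^*\le \tfrac1{24}.$$ (3) For every $1\le m\le n$, $$\mathbf{P}(T_n>m)\le\frac{4E_n}{B_m^{(n)}}$$ provided that $B_m^{(n)}:=\left(\sum_{k=1}^m\mathbf{E} X_{k,n}^2\right)^{1/2}\ge24(r_n+g_n^* )$.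
   Context: Setting: for each $n\ge1$ the random variables $X_{1,n},\dots,X_{n,n}$ are independent, with $\mathbf{E}X_{i,n}=0$ for all $i\le n$ and $\sum_{i=1}^n\mathbf{E}X_{i,n}^2=1$. There is a deterministic sequence $r_n\to0$ with $\max_{1\le i\le n}|X_{i,n}|\le r_n$ (almost surely). The numbers $g_{k,n}$, $1\le k\le n$, are real and deterministic with $g_n^*:=\max_{1\le k\le n}|g_{k,n}|\to0$. Put $S_{k,n}:=X_{1,n}+\dots+X_{k,n}$ and $$T_n:=\inf\{k\ge1:\ S_{k,n}\le g_{k,n}\},$$ so that $\{T_n>m\}=\{S_{k,n}>g_{k,n}\text{ for all }1\le k\le m\}$ for $m\le n$. It is assumed throughout that $\mathbf{P}(T_n>n)>0$ for all $n\ge1$. Finally, $E_n:=\mathbf{E}[S_{n,n}-g_{n,n};\,T_n>n]$, where $\mathbf{E}[Y;A]$ denotes $\mathbf{E}[Y\mathbf 1_A]$. *)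

(* Defs.v *)
From HB Require Import structures.
From mathcomp Require Import all_boot all_order all_algebra finmap.
From mathcomp Require Import all_classical all_reals all_analysis.

Set Implicit Arguments.
Unset Strict Implicit.
Unset Printing Implicit Defensive.

Import Order.TTheory GRing.Theory Num.Theory.
Import numFieldNormedType.Exports.

Local Open Scope classical_set_scope.
Local Open Scope ring_scope.

Definition independent_rvs (R : realType) (d : measure_display)
    (T : measurableType d) (P : probability T R) (I : choiceType)
    (D : set I) (X : I -> {RV P >-> R}) : Prop :=
  forall (J : {fset I}) (A : I -> set R),
    [set` J] `<=` D -> (forall i, i \in J -> measurable (A i)) ->
    P (\bigcap_(i in [set` J]) (X i @^-1` A i)) =
    (\prod_(i <- J) P (X i @^-1` A i))%E.

(* One row of the array is a sequence [X : nat -> T -> R] of which only the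
   entries with indices [1 <= i <= n] are meaningful; likewise for the
   boundary [g]. *)
Definition partial_sum (R : realType) (T : Type) (X : nat -> T -> R)
    (k : nat) (w : T) : R := \sum_(1 <= i < k.+1) X i w.

Definition bound_max (R : realType) (g : nat -> R) (n : nat) : R :=
  \big[Num.max/0]_(1 <= k < n.+1) `|g k|.

(* The boundary only exists up to time [n], so the infimum ranges over
   [1 <= k <= n]; it is [+oo] when the boundary is never crossed. *)
Definition crossing_time (R : realType) (T : Type) (X : nat -> T -> R)
    (g : nat -> R) (n : nat) (w : T) : \bar R :=
  ereal_inf [set (k%:R)%:E | k in
    [set k : nat | (1 <= k <= n)%N /\ partial_sum X k w <= g k]].

Definition survival (R : realType) (T : Type) (X : nat -> T -> R)
    (g : nat -> R) (n m : nat) : set T :=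
  [set w | ((m%:R)%:E < crossing_time X g n w)%E].

Definition expectation_on (R : realType) (d : measure_display)
    (T : measurableType d) (P : probability T R) (Y : T -> R) (A : set T) :
    \bar R := 'E_P[fun w => (Y w * \1_A w)%R]%E.

Definition mean_overshoot (R : realType) (d : measure_display)
    (T : measurableType d) (P : probability T R) (X : nat -> T -> R)
    (g : nat -> R) (n : nat) : \bar R :=
  expectation_on P (fun w => partial_sum X n w - g n) (survival X g n n).

Definition sum_sq_moments (R : realType) (d : measure_display)
    (T : measurableType d) (P : probability T R) (X : nat -> T -> R)
    (m : nat) : \bar R :=
  (\sum_(1 <= k < m.+1) 'E_P[fun w => (X k w ^+ 2)%R])%E.

Definition std_dev (R : realType) (d : measure_display)
    (T : measurableType d) (P : probability T R) (X : nat -> T -> R)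
    (m : nat) : R := Num.sqrt (fine (sum_sq_moments P X m)).

(* Main.v *)
Require Import Defs.
From HB Require Import structures.
From mathcomp Require Import all_boot all_order all_algebra finmap.
From mathcomp Require Import all_classical all_reals all_analysis.
From mathcomp Require Import measurable_realfun gauss_integral ring lra.

Set Implicit Arguments.
Unset Strict Implicit.
Unset Printing Implicit Defensive.

Import Order.TTheory GRing.Theory Num.Theory.
Import numFieldNormedType.Exports.

Local Open Scope classical_set_scope.
Local Open Scope ring_scope.

(* Let [t k] be the variance elapsed at time [k], [eps = r + g^*], [delta > 0]
   and [b k = sqrt (2 * (1 - t k + delta))].  As [erf (x / b)] solves the
   backward heat equation, [erf ((S k +- eps) / b k)] is almost a martingale up
   to the crossing time; a walk which dies is within [eps] of the origin, so the
   sign of the shift decides whether killing increases or decreases its mean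
   over the surviving paths.  At time [n] this mean is close to [P(T > n)],
   because [b n] is small; at the first time [m] with [t m >= eps ^ (2/3)], it
   is close to [sqrt (2 / pi) * E[S m; T > m]], because the walk is still
   near the origin, and [E[S m; T > m]] is [E_n] up to [O(eps P(T > m))].  The
   third derivatives of [erf] are dominated by [1 / (1 + z ^ 2)], and the
   resulting errors are controlled by the anticoncentration of [S k], proved by
   Stein's method, and by [P(T > m) * sqrt (t m) <= 4 E_n], which is Harris'
   inequality.  With [delta = eps ^ (4/3)] all errors are
   [O(eps ^ (2/3) E_n)]. *)

(** The exponent comes from a balance. Write [kappa = eps ^ (1/3)]. Linearising [erf] at elapsed
    variance [t m] costs [O(t m * E_n)], and the boundary costs [eps * P(T > m) = O(eps * E_n / sqrt
    (t m))]; both are [O(kappa ^ 2 * E_n)] when [t m] is about [kappa ^ 2]. The obstacle is the end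
    of the time interval, where the barrier approaches a sign function and its third derivative has
    size [b ^ -3]. The regularisation [delta] keeps [b ^ 2 >= 2 * r ^ 2], as the one-step expansion
    demands, at the price of a terminal layer of width about [sqrt delta = kappa ^ 2]. With the
    trivial bound 1 on the profile of the third derivative, the late errors would add up to the
    order of [r / sqrt delta], which may be as large as [kappa]. Anticoncentration gains one factor
    [b], so that the sum becomes logarithmic, and [kappa ^ 3 * log (1 / kappa)] is [O(kappa ^ 2)].
    Conditioning is replaced throughout by integrating one entry while the others are frozen. *)

Section taylor.
Context (R : realType).
Implicit Types (f : R -> R) (M a b z y : R).

Let derivative f f' := forall x : R, is_derive x 1 f (f' x).

Lemma is_deriveB_fun f h (x a b : R) : is_derive x 1 f a -> is_derive x 1 h b ->
  is_derive x 1 (fun y => f y - h y) (a - b).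
Proof. by move=> df dh; exact: is_deriveB. Qed.

Lemma is_deriveZ_fun f (c x a : R) : is_derive x 1 f a ->
  is_derive x 1 (fun y => c * f y) (c * a).
Proof. by move=> df; exact: is_deriveZ. Qed.

Lemma is_deriveM_fun f h (x a b : R) : is_derive x 1 f a -> is_derive x 1 h b ->
  is_derive x 1 (fun y => f y * h y) (f x * b + h x * a).
Proof. by move=> df dh; exact: is_deriveM. Qed.

Lemma mvt_bound f f' M a b : derivative f f' ->
  (forall x, `|x - a| <= `|b - a| -> `|f' x| <= M) ->
  `|f b - f a| <= M * `|b - a|.
Proof.
move=> df fM.
have cf u v : {within `[u, v], continuous f}.
  apply: derivable_within_continuous => x _; exact: (@ex_derive _ _ _ _ _ _ _ (df x)).
have [ab|ba] := leP a b.
  have [c + ->] := MVT_segment ab (fun x _ => df x) (cf a b).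
  rewrite in_itv/= => /andP[ac cb].
  rewrite normrM ler_wpM2r// fM// !ger0_norm; lra.
have [c + h] := MVT_segment (ltW ba) (fun x _ => df x) (cf b a).
rewrite in_itv/= => /andP[bc ca].
rewrite distrC h normrM (distrC b a) ler_wpM2r// fM//.
by rewrite distrC (distrC b a) !ger0_norm; lra.
Qed.

Lemma derivative_affine f f' c e z : derivative f f' ->
  derivative (fun y => f y - c - e * (y - z)) (fun y => f' y - e).
Proof.
move=> df x.
apply: (@is_derive_eq _ _ _ _ _ _ _ (f' x - 0 - e * (1 - 0))).
  exact: (is_deriveB_fun (is_deriveB_fun (df x) (is_derive_cst c x 1))
    (is_deriveZ_fun e (is_deriveB_fun (is_derive_id x 1) (is_derive_cst z x 1)))).
by rewrite !subr0 mulr1.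
Qed.

(** Iterating the mean value inequality loses the factor 1/2 (and 1/6 in [taylor3]); only the order
    of the remainder matters later. The bound is asked on a ball around [z], so that both signs of
    [y - z] are covered at once. *)
Lemma taylor2 f f1 f2 M z y : derivative f f1 -> derivative f1 f2 ->
  (forall x, `|x - z| <= `|y - z| -> `|f2 x| <= M) ->
  `|f y - f z - f1 z * (y - z)| <= M * `|y - z| ^+ 2.
Proof.
move=> d1 d2 fM.
have M0 : 0 <= M by apply: le_trans (fM z _); rewrite ?normr_ge0// subrr normr0.
have := @mvt_bound _ _ (M * `|y - z|) z y (derivative_affine (f z) (f1 z) z d1).
rewrite !subrr mulr0 !subr0 expr2 mulrA; apply.
move=> x xz; apply: (le_trans (mvt_bound d2 _)).
  by move=> u ux; apply: fM; exact: le_trans xz.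
by rewrite ler_wpM2l.
Qed.

Lemma taylor3 f f1 f2 f3 M z y :
  derivative f f1 -> derivative f1 f2 -> derivative f2 f3 ->
  (forall x, `|x - z| <= `|y - z| -> `|f3 x| <= M) ->
  `|f y - f z - f1 z * (y - z) - f2 z * (y - z) ^+ 2 / 2| <=
  M * `|y - z| ^+ 3.
Proof.
move=> d1 d2 d3 fM.
have M0 : 0 <= M by apply: le_trans (fM z _); rewrite ?normr_ge0// subrr normr0.
pose G y := f y - f z - f1 z * (y - z) - f2 z * (y - z) ^+ 2 / 2.
have dG : derivative G (fun y => f1 y - f1 z - f2 z * (y - z)).
  move=> x; pose D := (x - z) * (1 - 0) + (x - z) * (1 - 0).
  apply: (@is_derive_eq _ _ _ _ _ _ _ ((f1 x - f1 z) - (f2 z / 2) * D)).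
    rewrite (_ : G = fun y => (f y - f z - f1 z * (y - z)) -
      (f2 z / 2) * ((y - z) * (y - z))); last first.
      by apply/funext => u; rewrite /G; ring.
    have dz := is_deriveB_fun (is_derive_id x 1) (is_derive_cst z x 1).
    exact: (is_deriveB_fun (derivative_affine (f z) (f1 z) z d1 x)
      (is_deriveZ_fun _ (is_deriveM_fun dz dz))).
  by rewrite /D; field.
have -> : M * `|y - z| ^+ 3 = M * `|y - z| ^+ 2 * `|y - z|.
  by rewrite -mulrA -exprSr.
have Gz : G z = 0 by rewrite /G !subrr expr0n /= !mulr0 mul0r !subr0.
have := @mvt_bound _ _ (M * `|y - z| ^+ 2) z y dG.
rewrite Gz subr0; apply => x xz.
apply: (le_trans (taylor2 d2 d3 _)).
  by move=> u ux; apply: fM; exact: le_trans xz.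
by rewrite ler_wpM2l// lerXn2r ?nnegrE.
Qed.

End taylor.

(** * The error function: derivatives, decay and the one-step heat expansion *)

Section erf.
Context (R : realType).
Implicit Types x z : R.
Let mu := @lebesgue_measure R.

(** Starting the integral at -oo lets one form of the fundamental theorem of calculus cover the
    whole line; [gint0] then shows that [erf] is the usual function vanishing at 0. *)
Definition gint x := \int[mu]_(u in `]-oo, x]) gauss_fun u.
Definition erf x := 2 / Num.sqrt pi * gint x - 1.
Definition erf1 x := 2 / Num.sqrt pi * gauss_fun x.
Definition erf2 x := - (2 * x) * erf1 x.
Definition erf3 x := (4 * x ^+ 2 - 2) * erf1 x.

Let igauss (D : set R) : measurable D -> mu.-integrable D (EFin \o gauss_fun).
Proof. by move=> mD; apply: integrableS (@integrableT_gauss R). Qed.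

Lemma is_derive_gint x : is_derive x 1 gint (gauss_fun x).
Proof.
have [d1 d2] := @continuous_FTC1 R gauss_fun -oo%O x (x + 1)
  (ltr_pwDr ltr01 (lexx x)) (igauss (measurable_itv _)) (ltNyr x) (@continuous_gauss_fun R x).
by apply: DeriveDef; [exact: d1|rewrite -derive1E; exact: d2].
Qed.

Lemma is_derive_erf x : is_derive x 1 erf (erf1 x).
Proof.
apply: (@is_derive_eq _ _ _ _ _ _ _ ((2 / Num.sqrt pi) * gauss_fun x - 0)).
  exact: (is_deriveB_fun (is_deriveZ_fun (2 / Num.sqrt pi) (is_derive_gint x))
    (is_derive_cst (1 : R) x 1)).
by rewrite subr0.
Qed.

Lemma is_derive_gauss x : is_derive x 1 (@gauss_fun R) (- (2 * x) * gauss_fun x).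
Proof.
have d : is_derive x 1 (fun u : R => 0 - u * u) (0 - (x * 1 + x * 1)).
  exact: (is_deriveB_fun (is_derive_cst 0 x 1)
    (is_deriveM_fun (is_derive_id x 1) (is_derive_id x 1))).
rewrite (_ : gauss_fun = expR \o (fun u : R => 0 - u * u)); last first.
  by apply/funext => u; rewrite /gauss_fun /= sub0r expr2.
have d' := @is_derive1_comp R expR (fun u => 0 - u * u) x _ _ (is_derive_expR _) d.
apply: (is_derive_eq d'); rewrite /gauss_fun /= sub0r -expr2.
by set e := expR _; ring.
Qed.

Lemma is_derive_erf1 x : is_derive x 1 erf1 (erf2 x).
Proof.
apply: (@is_derive_eq _ _ _ _ _ _ _ ((2 / Num.sqrt pi) * (- (2 * x) * gauss_fun x))).
  exact: (is_deriveZ_fun (2 / Num.sqrt pi) (is_derive_gauss x)).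
by rewrite /erf2 /erf1; ring.
Qed.

Lemma is_derive_erf2 x : is_derive x 1 erf2 (erf3 x).
Proof.
have d : is_derive x 1 (fun u => (- 2 * u) * erf1 u) ((- 2 * x) * erf2 x + erf1 x * (- 2 * 1)).
  exact: (is_deriveM_fun (is_deriveZ_fun (-2) (is_derive_id x 1)) (is_derive_erf1 x)).
rewrite (_ : erf2 = fun u => (- 2 * u) * erf1 u); last first.
  by apply/funext => u; rewrite /erf2; ring.
by apply: (is_derive_eq d); rewrite /erf3 /erf2; ring.
Qed.

Let itvT : [set` `]-oo, +oo[ ] = [set: R].
Proof. by apply/seteqP; split => x //=; rewrite in_itv. Qed.

Let gintB x (b : itv_bound R) : (BRight x <= b)%O ->
  \int[mu]_(u in [set` Interval -oo%O b]) gauss_fun u - gint x =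
  \int[mu]_(u in [set` Interval (BLeft x) b]) gauss_fun u.
Proof.
move=> xb; rewrite /gint Rintegral_itvB//; last exact: igauss.
by rewrite Rintegral_itv_obnd_cbnd//; exact: igauss.
Qed.

Let gintT : \int[mu]_(u in [set` `]-oo, +oo[ ]) gauss_fun u = Num.sqrt pi.
Proof. by rewrite itvT /Rintegral integralT_gauss. Qed.

Lemma gint0 : gint 0 = Num.sqrt pi / 2.
Proof.
have := @gintB 0 +oo%O isT; rewrite gintT.
rewrite [X in _ = X -> _]/Rintegral integral0y_gauss /= => h.
by lra.
Qed.

Let sqrtpi_gt0 : 0 < Num.sqrt pi :> R.
Proof. by rewrite sqrtr_gt0 pi_gt0. Qed.

Let sqrtpi_ge1 : 1 <= Num.sqrt pi :> R.
Proof. by rewrite -[leLHS]sqrtr1 ler_sqrt ?pi_ge0// (le_trans _ (pi_ge2 R))// ler1n. Qed.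

Lemma erf0 : erf 0 = 0.
Proof. by rewrite /erf gint0; field; rewrite gt_eqF. Qed.

Lemma erf_nondecreasing : {homo erf : x y / x <= y}.
Proof.
move=> x y xy; rewrite /erf lerD2r ler_pM2l ?divr_gt0// -subr_ge0.
rewrite (@gintB x (BRight y)) ?bnd_simp//.
by apply: Rintegral_ge0 => u _; exact: gauss_fun_ge0.
Qed.

Lemma normr_erf_le1 x : `|erf x| <= 1.
Proof.
have h1 : 0 <= gint x by apply: Rintegral_ge0 => u _; exact: gauss_fun_ge0.
have h2 : gint x <= Num.sqrt pi.
  rewrite -subr_ge0 -gintT (@gintB x +oo%O)//.
  by apply: Rintegral_ge0 => u _; exact: gauss_fun_ge0.
rewrite ler_norml /erf; apply/andP; split.
  by rewrite lerBrDr addNr mulr_ge0// divr_ge0.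
rewrite lerBlDr -mulrA [X in _ * X]mulrC.
have : gint x / Num.sqrt pi <= 1 by rewrite ler_pdivrMr// mul1r.
lra.
Qed.

Lemma erf_ge0 x : 0 <= x -> 0 <= erf x.
Proof. by move=> x0; rewrite -erf0; exact: erf_nondecreasing. Qed.

Lemma erf_le0 x : x <= 0 -> erf x <= 0.
Proof. by move=> x0; rewrite -erf0; exact: erf_nondecreasing. Qed.

(** This is the limit 1 of [erf] at infinity, in the form used by [erf_tail]. The known limit is
    that of the squared Gaussian integral over [[0, y]], namely [pi / 4], so the bound on [erf] is
    squared before passing to the limit. *)
Lemma erf_lim_le z b : (forall y, z <= y -> erf y <= b) -> 1 <= b.
Proof.
move=> hb; have b0 : 0 <= b.
  have := hb (Num.max z 0); rewrite le_max lexx => /(_ isT).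
  by apply: le_trans; apply: erf_ge0; rewrite le_max lexx orbT.
have h : pi / 4 <= (Num.sqrt pi / 2 * b) ^+ 2.
  have lc := @gauss_integral_proof.cvg_integral0_gauss_sqr R.
  rewrite -(cvg_lim (@Rhausdorff R) lc); apply: limr_le; first exact: cvgP lc.
  near=> y; rewrite lerXn2r ?nnegrE ?gauss_integral_proof.integral0_gauss_ge0//.
    by rewrite mulr_ge0 ?divr_ge0.
  have y0 : 0 <= y by near: y; apply: nbhs_pinfty_ge; exact: num_real.
  have zy : z <= y by near: y; apply: nbhs_pinfty_ge; exact: num_real.
  have := hb y zy; rewrite /erf.
  have := @gintB 0 (BRight y); rewrite bnd_simp y0 => /(_ isT).
  rewrite -/(gint y) gint0 => eq1.
  rewrite /gauss_integral_proof.integral0_gauss -/mu -eq1.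
  move=> hy; rewrite (_ : _ - _ = Num.sqrt pi / 2 * (2 / Num.sqrt pi * gint y - 1)).
    by rewrite ler_wpM2l// divr_ge0.
  by field; rewrite gt_eqF.
have p4 : 0 < pi / 4 :> R by rewrite divr_gt0// pi_gt0.
move: h; rewrite !exprMn exprVn sqr_sqrtr ?pi_ge0//.
have -> : (2 ^+ 2 : R) = 4 by ring.
rewrite -[leLHS]mulr1 ler_pM2l// -[leLHS](expr1n _ 2).
by rewrite ler_pXn2r ?nnegrE.
Unshelve. all: end_near.
Qed.

(** The power 4 absorbs the polynomial factors of the derivatives of [erf] and still leaves a factor
    [lorentz]. The constant comes from [1 + x ^ 2 <= 4 * (1 + x ^ 2 / 4)] and [1 + y <= expR y] at
    [y = x ^ 2 / 4]. *)
Lemma gauss_decay : exists2 K : R, 2 <= K &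
  forall x, gauss_fun x * (1 + x ^+ 2) ^+ 4 <= K.
Proof.
exists (4 ^+ 4) => [|x]; first by rewrite -natrX ler_nat.
have x2 := sqr_ge0 x.
have h : (1 + x ^+ 2 / 4) ^+ 4 <= expR (x ^+ 2).
  rewrite [X in expR X](_ : x ^+ 2 = 4%:R * (x ^+ 2 / 4)); last by field.
  rewrite expRM_natl lerXn2r ?nnegrE ?expR_ge0 ?expR_ge1Dx//.
  by rewrite addr_ge0// divr_ge0.
rewrite /gauss_fun expRN ler_pdivrMl ?expR_gt0//.
have h2 : (1 + x ^+ 2) ^+ 4 <= 4 ^+ 4 * (1 + x ^+ 2 / 4) ^+ 4.
  rewrite -exprMn; apply: lerXn2r; rewrite ?nnegrE; lra.
by apply: (le_trans h2); rewrite mulrC; apply: ler_wpM2r.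
Qed.

Variable K : R.
Hypothesis K2 : 2 <= K.
Hypothesis gaussK : forall x, gauss_fun x * (1 + x ^+ 2) ^+ 4 <= K.

Let K0 : 0 < K. Proof. exact: lt_le_trans K2. Qed.

(** The common majorant of the expansion errors. Its polynomial decay makes it comparable with
    itself under bounded shifts, and it is the derivative of [atan], the test function of the
    anticoncentration bound. *)
Definition lorentz z : R := (1 + z ^+ 2)^-1.
Local Notation q := lorentz.

Lemma lorentz_gt0 z : 0 < q z.
Proof. by rewrite invr_gt0 ltr_pwDl// sqr_ge0. Qed.

Lemma lorentz_le1 z : q z <= 1.
Proof. by rewrite invf_le1 ?ltr_pwDl ?sqr_ge0// lerDl sqr_ge0. Qed.

Lemma lorentzK z : q z * (1 + z ^+ 2) = 1.
Proof. by rewrite /lorentz mulVf// gt_eqF// ltr_pwDl ?sqr_ge0. Qed.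

Let q_pow z k : q z ^+ k.+1 <= q z.
Proof.
by rewrite exprS ler_piMr ?(ltW (lorentz_gt0 z))// exprn_ile1 ?lorentz_le1// ltW ?lorentz_gt0.
Qed.

Lemma erf1_ge0 x : 0 <= erf1 x.
Proof. by rewrite mulr_ge0 ?gauss_fun_ge0// divr_ge0. Qed.

Lemma erf1_decay x : erf1 x <= 2 * K * q x ^+ 4.
Proof.
have h := gaussK x; have q0 := lorentz_gt0 x.
have : gauss_fun x <= K * q x ^+ 4.
  have -> : gauss_fun x = gauss_fun x * (1 + x ^+ 2) ^+ 4 * q x ^+ 4.
    by rewrite -mulrA -exprMn [_ * q x]mulrC lorentzK expr1n mulr1.
  by rewrite ler_wpM2r ?exprn_ge0 ?(ltW q0).
have g0 := gauss_fun_ge0 x.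
have : 2 / Num.sqrt pi <= 2 :> R by rewrite ler_pdivrMr// ler_peMr.
by rewrite /erf1 => h1 h2; apply: (le_trans (ler_wpM2r g0 h1)); lra.
Qed.

(** For [z <= 1] the right-hand side is at least 1. Beyond 1 the function [erf + erf1 / 2] has
    derivative [(1 - c) * erf1 c <= 0], so the limit of [erf] is at most its value at [z]. *)
Lemma erf_tail z : 0 <= z -> 1 - erf z <= K * q z.
Proof.
move=> z0; have q0 := lorentz_gt0 z; have qq := lorentzK z.
have [z1|z1] := leP z 1.
  have e0 := erf_ge0 z0; have z2 : z ^+ 2 <= 1 by rewrite expr_le1.
  have h1 : 1 <= 2 * q z by nra.
  have h2 : 2 * q z <= K * q z by rewrite ler_wpM2r// ltW.
  by lra.
have phi_le y : z <= y -> erf y <= erf z + 2^-1 * erf1 z.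
  move=> zy.
  pose phi y := erf y - (- 2^-1) * erf1 y.
  have dphi x : is_derive x 1 phi (erf1 x - (- 2^-1) * erf2 x).
    exact: (is_deriveB_fun (is_derive_erf x) (is_deriveZ_fun _ (is_derive_erf1 x))).
  have cphi : {within `[z, y], continuous phi}.
    apply: derivable_within_continuous => x _.
    exact: (@ex_derive _ _ _ _ _ _ _ (dphi x)).
  have [c + h] := MVT_segment zy (fun x _ => dphi x) cphi.
  rewrite in_itv/= => /andP[zc cy]; move: h.
  rewrite (_ : erf1 c - _ = - ((c - 1) * erf1 c)); last by rewrite /erf2; field.
  have h1 : 0 <= (c - 1) * erf1 c * (y - z).
    apply: mulr_ge0; last by rewrite subr_ge0.
    by apply: mulr_ge0; [rewrite subr_ge0 (le_trans (ltW z1))|exact: erf1_ge0].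
  have := erf1_ge0 y; rewrite mulNr /phi => h2 h3; lra.
have h1 := erf_lim_le phi_le; have h2 := erf1_decay z.
have h3 : K * q z ^+ 4 <= K * q z by rewrite ler_wpM2l ?q_pow// ltW.
by lra.
Qed.

Lemma lorentz_shift z x : `|x - z| <= 1 -> q x <= 3 * q z.
Proof.
rewrite ler_norml => /andP[h1 h2].
have qx := lorentzK x; have qz := lorentzK z; have x0 := lorentz_gt0 x; have z0 := lorentz_gt0 z.
have h : 1 + z ^+ 2 <= 3 * (1 + x ^+ 2).
  have := sqr_ge0 (x + (x - z)); nra.
have -> : q x = q z * (q x * (1 + z ^+ 2)) by rewrite mulrCA qz mulr1.
rewrite mulrC ler_pM2r//.
have -> : 3 = q x * (3 * (1 + x ^+ 2)) by rewrite mulrCA qx mulr1.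
by rewrite ler_pM2l.
Qed.

Lemma erf3_decay x : `|erf3 x| <= 8 * K * q x.
Proof.
rewrite /erf3 normrM (ger0_norm (erf1_ge0 x)).
have h := erf1_decay x; have q0 := lorentz_gt0 x; have q1 := lorentz_le1 x; have qq := lorentzK x.
have hx : `|4 * x ^+ 2 - 2| <= 4 * (1 + x ^+ 2).
  by have x2 := sqr_ge0 x; rewrite ler_norml; apply/andP; split; lra.
apply: (le_trans (ler_pM _ (erf1_ge0 x) hx h)) => //.
rewrite [leLHS](_ : _ = 8 * K * (q x * (1 + x ^+ 2)) * q x ^+ 3); last by ring.
by rewrite qq mulr1; apply: ler_wpM2l; [rewrite mulr_ge0// ltW|exact: q_pow].
Qed.

Lemma erf2_decay x : x ^+ 2 * `|erf2 x| <= 2 * K * q x.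
Proof.
rewrite /erf2 normrM (ger0_norm (erf1_ge0 x)).
have h := erf1_decay x; have q0 := lorentz_gt0 x; have q1 := lorentz_le1 x; have qq := lorentzK x.
have hx : x ^+ 2 * `|- (2 * x)| <= (1 + x ^+ 2) ^+ 2.
  rewrite normrN normrM ger0_norm// -real_normK ?num_real//.
  have := normr_ge0 x; set y := `|x|; nra.
rewrite mulrA; apply: (le_trans (ler_pM _ (erf1_ge0 x) hx h)).
  by rewrite mulr_ge0 ?sqr_ge0.
rewrite [leLHS](_ : _ = 2 * K * (q x * (1 + x ^+ 2)) ^+ 2 * q x ^+ 2); last by ring.
rewrite qq expr1n mulr1.
by apply: ler_wpM2l; [rewrite mulr_ge0// ltW|exact: q_pow].
Qed.

Lemma xerf1_decay x : `|x * erf1 x| <= 2 * K * q x.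
Proof.
rewrite normrM (ger0_norm (erf1_ge0 x)).
have h := erf1_decay x; have q0 := lorentz_gt0 x; have q1 := lorentz_le1 x; have qq := lorentzK x.
have hx : `|x| <= 1 + x ^+ 2.
  by rewrite -real_normK ?num_real//; set y := `|x|; nra.
apply: (le_trans (ler_pM _ (erf1_ge0 x) hx h)) => //.
rewrite [leLHS](_ : _ = 2 * K * (q x * (1 + x ^+ 2)) * q x ^+ 3); last by ring.
by rewrite qq mulr1; apply: ler_wpM2l; [rewrite mulr_ge0// ltW|exact: q_pow].
Qed.

Lemma erf_near0 x : `|erf x - 2 / Num.sqrt pi * x| <= 8 * K * `|x| ^+ 3.
Proof.
have := @taylor3 R erf erf1 erf2 erf3 (8 * K) 0 x is_derive_erf is_derive_erf1 is_derive_erf2.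
rewrite !subr0 erf0 subr0 {1}/erf2 mulr0 oppr0 !mul0r subr0 /erf1 /gauss_fun.
rewrite expr0n /= oppr0 expR0 mulr1; apply => y _.
apply: (le_trans (erf3_decay y)); rewrite -[leRHS]mulr1.
by apply: ler_wpM2l; [rewrite mulr_ge0// ltW|exact: lorentz_le1].
Qed.

(** The backward heat equation in units where the new scale is 1: [z] is the old position, [xi] the
    increment and [l] the ratio of new to old scale. Since [erf2 z = - 2 * z * erf1 z], the change
    of scale [l * z - z], about [- u * z / 2], contributes [erf2 z * u / 4]; it cancels the second
    order term in [xi] when [xi ^ 2] has mean [u / 2]. *)
Lemma erf_step z xi u l rho : 0 <= u -> 0 <= l -> l ^+ 2 * (1 + u) = 1 ->
  0 <= rho -> rho ^+ 2 <= 2^-1 -> `|xi| <= rho -> u <= 2 * rho ^+ 2 ->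
  `|erf (z + xi) - erf (l * z) - erf1 z * xi - erf2 z / 2 * (xi ^+ 2 - u / 2)|
  <= 24 * K * rho * (xi ^+ 2 + u) * q z.
Proof.
move=> u0 l0 lu rho0 rho1 xirho urho.
have rho_le1 : rho <= 1 by nra.
have u1 : u <= 1 by lra.
have l1 : l <= 1 by nra.
have q0 := lorentz_gt0 z.
have A : `|erf (z + xi) - erf z - erf1 z * xi - erf2 z * xi ^+ 2 / 2| <=
    24 * K * q z * `|xi| ^+ 3.
  have := @taylor3 R erf erf1 erf2 erf3 (24 * K * q z) z (z + xi) is_derive_erf
    is_derive_erf1 is_derive_erf2.
  rewrite addrC addKr; apply => x xz.
  rewrite (le_trans (erf3_decay x))//.
  have hs := lorentz_shift (le_trans xz (le_trans xirho rho_le1)).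
  have : 8 * K * q x <= 8 * K * (3 * q z) by rewrite ler_wpM2l// mulr_ge0// ltW.
  lra.
have l_le : 1 - l <= u by nra.
(* The displacement [l * z - z] is unbounded in [z], so a bound on [erf2] alone is too weak. As
   [l ^ 2 >= 1 / 2], the points of the ball satisfy [x ^ 2 >= z ^ 2 / 2], and the bound on
   [x ^ 2 * erf2 x] pays for the factor [z ^ 2]. *)
have B : `|erf (l * z) - erf z - erf1 z * (l * z - z)| <=
    8 * K * q z * (1 - l) ^+ 2.
  have [->|z0] := eqVneq z 0.
    rewrite mulr0 !subrr mulr0 subr0 normr0; apply: mulr_ge0; last exact: sqr_ge0.
    by rewrite mulr_ge0 ?(ltW (lorentz_gt0 _))// mulr_ge0// ltW.
  have z2 : 0 < z ^+ 2 by rewrite exprn_even_gt0.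
  have := @taylor2 R erf erf1 erf2 (8 * K * q z / z ^+ 2) z (l * z)
    is_derive_erf is_derive_erf1.
  have eM : 8 * K * q z / z ^+ 2 * `|l * z - z| ^+ 2 = 8 * K * q z * (1 - l) ^+ 2.
    by rewrite real_normK ?num_real//; field.
  rewrite eM; apply=> x; rewrite (_ : l * z - z = (l - 1) * z); last by ring.
  move=> xz.
  have zx : z ^+ 2 <= 2 * x ^+ 2.
    have h : l * `|z| <= `|x|.
      have h1 := lerB_dist z x; rewrite distrC in h1.
      have : `|x - z| <= (1 - l) * `|z|.
        by apply: (le_trans xz); rewrite normrM ler0_norm ?opprB// subr_le0.
      lra.
    have : l ^+ 2 * z ^+ 2 <= x ^+ 2.
      rewrite -(real_normK (num_real x)) -(real_normK (num_real z)) -exprMn.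
      by rewrite lerXn2r ?nnegrE ?mulr_ge0.
    nra.
  have qxz : q x <= 2 * q z.
    have qx := lorentzK x; have qz := lorentzK z; have x0 := lorentz_gt0 x.
    have -> : q x = q z * (q x * (1 + z ^+ 2)) by rewrite mulrCA qz mulr1.
    rewrite mulrC ler_pM2r//.
    have -> : 2 = q x * (2 * (1 + x ^+ 2)) by rewrite mulrCA qx mulr1.
    by rewrite ler_pM2l//; have := sqr_ge0 x; lra.
  rewrite ler_pdivlMr//.
  have h1 := ler_wpM2r (normr_ge0 (erf2 x)) zx.
  have h2 : 4 * K * q x <= 4 * K * (2 * q z) by rewrite ler_wpM2l// mulr_ge0// ltW.
  have h3 := erf2_decay x; rewrite mulrC; lra.
have C : `|1 - l - u / 2| <= u ^+ 2.
  have h0 : 1 - l ^+ 2 = l ^+ 2 * u by lra.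
  have h1 : (1 + l) * (1 - l - u / 2) = - (u * (1 - l) * (2 * l + 1) / 2).
    transitivity ((1 - l ^+ 2) - u * (1 + l) / 2); first by field.
    by rewrite h0; field.
  have h2 : 0 <= u * (1 - l) by rewrite mulr_ge0// subr_ge0.
  have h3 : 0 <= (1 + l) * (u ^+ 2 - u * (1 - l)).
    apply: mulr_ge0; first by rewrite addr_ge0.
    by rewrite subr_ge0 expr2 ler_wpM2l.
  have h4 : 0 <= u * (1 - l) * l by exact: mulr_ge0.
  have h5 : 0 <= (1 + l) * u ^+ 2 by rewrite mulr_ge0 ?sqr_ge0// addr_ge0.
  have l1' : 0 < 1 + l by rewrite ltr_pwDl.
  by rewrite ler_norml; apply/andP; split; rewrite -(ler_pM2l l1') h1; lra.
have D := xerf1_decay z.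
have -> : erf (z + xi) - erf (l * z) - erf1 z * xi - erf2 z / 2 * (xi ^+ 2 - u / 2) =
    (erf (z + xi) - erf z - erf1 z * xi - erf2 z * xi ^+ 2 / 2) -
    (erf (l * z) - erf z - erf1 z * (l * z - z)) +
    z * erf1 z * (1 - l - u / 2).
  by rewrite /erf2; field.
apply: (le_trans (ler_normD _ _)); rewrite normrM.
have CD : `|z * erf1 z| * `|1 - l - u / 2| <= 2 * K * q z * u ^+ 2 by exact: ler_pM.
have AB := ler_normB (erf (z + xi) - erf z - erf1 z * xi - erf2 z * xi ^+ 2 / 2)
  (erf (l * z) - erf z - erf1 z * (l * z - z)).
have l2 : (1 - l) ^+ 2 <= u ^+ 2 by rewrite lerXn2r ?nnegrE ?subr_ge0.
have uu : u ^+ 2 <= 2 * rho * u by nra.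
have xx : `|xi| ^+ 3 <= rho * xi ^+ 2.
  by rewrite exprS real_normK ?num_real// ler_wpM2r ?sqr_ge0.
have hq : K * q z * (24 * `|xi| ^+ 3 + 8 * (1 - l) ^+ 2 + 2 * u ^+ 2) <=
    K * q z * (24 * rho * (xi ^+ 2 + u)).
  rewrite ler_pM2l ?mulr_gt0//.
  have : 0 <= rho * u by exact: mulr_ge0.
  lra.
lra.
Qed.

(** Scaled form of [erf_step], with [b'] and [b] the scales before and after the step. The two
    subtracted correction terms have mean zero when [x] is centred with variance [v];
    [2 * r ^ 2 <= b ^ 2] keeps the scaled increment small. *)
Lemma erf_heat_step (b b' s x v r : R) : 0 < b -> 0 < b' ->
  b' ^+ 2 = b ^+ 2 + 2 * v -> 0 <= v -> v <= r ^+ 2 -> 2 * r ^+ 2 <= b ^+ 2 ->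
  `|x| <= r ->
  `|erf ((s + x) / b) - erf (s / b') - erf1 (s / b) / b * x -
    erf2 (s / b) / (2 * b ^+ 2) * (x ^+ 2 - v)| <=
  48 * K * r / b ^+ 3 * (x ^+ 2 + v) * q (s / b).
Proof.
move=> b0 b'0 bb v0 vr rb xr.
have r0 : 0 <= r by exact: le_trans xr.
have bn0 : b != 0 by rewrite gt_eqF.
have b'n0 : b' != 0 by rewrite gt_eqF.
have b20 : 0 < b ^+ 2 by rewrite exprn_gt0.
have h := @erf_step (s / b) (x / b) (2 * v / b ^+ 2) (b / b') (r / b).
have e1 : s / b + x / b = (s + x) / b by rewrite mulrDl.
have e2 : b / b' * (s / b) = s / b' by field; rewrite ?bn0 ?b'n0 ?d0.
have e3 : erf2 (s / b) / 2 * ((x / b) ^+ 2 - 2 * v / b ^+ 2 / 2) =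
  erf2 (s / b) / (2 * b ^+ 2) * (x ^+ 2 - v) by field; rewrite ?bn0.
have e4 : erf1 (s / b) * (x / b) = erf1 (s / b) / b * x by field; rewrite ?bn0.
rewrite e1 e2 e3 e4 in h; apply: (le_trans (h _ _ _ _ _ _ _)).
- by rewrite divr_ge0 ?mulr_ge0// ltW.
- by rewrite divr_ge0 ?ltW.
- rewrite exprMn exprVn bb.
  have d0 : b ^+ 2 + 2 * v != 0 by rewrite gt_eqF// ltr_pwDl// mulr_ge0.
  by field; rewrite ?bn0 ?b'n0 ?d0.
- by rewrite divr_ge0// ltW.
- by rewrite exprMn exprVn ler_pdivrMr//; lra.
- by rewrite normrM normfV (gtr0_norm b0) ler_pM2r ?invr_gt0.
- rewrite exprMn exprVn mulrA ler_pM2r ?invr_gt0//; lra.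
have q0 := lorentz_gt0 (s / b).
rewrite ler_pM2r// (_ : _ * (_ + _) = 24 * K * r / b ^+ 3 * (x ^+ 2 + 2 * v)); last by field; rewrite ?bn0.
rewrite (_ : 48 * K * r / b ^+ 3 * _ = 24 * K * r / b ^+ 3 * (2 * x ^+ 2 + 2 * v)); last by field; rewrite ?bn0.
apply: ler_wpM2l; last by rewrite lerD2r; have := sqr_ge0 x; lra.
apply: mulr_ge0; last by rewrite invr_ge0 exprn_ge0// ltW.
by rewrite !mulr_ge0// ltW.
Qed.

End erf.

(** * Bounded measurable functions *)

Section bounded_measurable.
Context (R : realType) (d : measure_display) (T : measurableType d).

(** Boundedness at every point gives a class closed under the algebraic operations and always
    integrable. The measurable type is left general so that [bm] over a smaller sigma-algebra
    expresses dependence on some entries only. *)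
Definition bm (f : T -> R) : Prop :=
  measurable_fun setT f /\ exists M : R, forall w, `|f w| <= M.

Lemma bm_cst (c : R) : bm (fun=> c).
Proof. by split; [exact: measurable_cst|exists `|c|]. Qed.

Lemma bmD (f h : T -> R) : bm f -> bm h -> bm (fun w => f w + h w).
Proof.
move=> [mf [M fM]] [mh [N hN]]; split; first exact: measurable_funD.
by exists (M + N) => w; rewrite (le_trans (ler_normD _ _))// lerD.
Qed.

Lemma bmN (f : T -> R) : bm f -> bm (fun w => - f w).
Proof.
move=> [mf [M fM]]; split; first exact: measurableT_comp.
by exists M => w; rewrite normrN.
Qed.

Lemma bmB (f h : T -> R) : bm f -> bm h -> bm (fun w => f w - h w).
Proof. by move=> bf bh; apply: bmD => //; exact: bmN. Qed.

Lemma bmM (f h : T -> R) : bm f -> bm h -> bm (fun w => f w * h w).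
Proof.
move=> [mf [M fM]] [mh [N hN]]; split; first exact: measurable_funM.
by exists (M * N) => w; rewrite normrM ler_pM.
Qed.

Lemma bmX (f : T -> R) n : bm f -> bm (fun w => f w ^+ n).
Proof.
move=> bf; elim: n => [|n IH].
  by under eq_fun do rewrite expr0; exact: bm_cst.
by under eq_fun do rewrite exprS; exact: bmM.
Qed.

Lemma bm_sum (I : Type) (s : seq I) (Q : pred I) (f : I -> T -> R) :
  (forall i, Q i -> bm (f i)) -> bm (fun w => \sum_(i <- s | Q i) f i w).
Proof.
move=> bf; elim: s => [|i s IH].
  by under eq_fun do rewrite big_nil; exact: bm_cst.
under eq_fun do rewrite big_cons.
by case: (boolP (Q i)) => // Qi; apply: bmD => //; exact: bf.
Qed.

Lemma bm_norm (f : T -> R) : bm f -> bm (fun w => `|f w|).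
Proof.
move=> [mf [M fM]]; split; first exact: measurableT_comp.
by exists M => w; rewrite normr_id.
Qed.

Lemma bm_max (f h : T -> R) : bm f -> bm h -> bm (fun w => Num.max (f w) (h w)).
Proof.
move=> [mf [M fM]] [mh [N hN]]; split; first exact: measurable_maxr.
exists (Num.max M N) => w; rewrite le_max.
by case: (leP (f w) (h w)) => _; rewrite ?fM ?hN ?orbT.
Qed.

Lemma bm_comp (u : R -> R) (f : T -> R) (M : R) : measurable_fun setT u ->
  (forall x, `|u x| <= M) -> bm f -> bm (fun w => u (f w)).
Proof.
by move=> mu uM [mf _]; split; [exact: measurableT_comp|exists M].
Qed.

Lemma bm_nondecreasing (u : R -> R) (f : T -> R) :
  {homo u : x y / x <= y} -> bm f -> bm (fun w => u (f w)).
Proof.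
move=> ndu [mf [M fM]]; split.
  apply: measurableT_comp => //; apply: nondecreasing_measurable => //.
exists (`|u (- M)| + `|u M|) => w.
have /andP[lo hi] : - M <= f w <= M by rewrite -ler_norml.
have ulo := ndu _ _ lo; have uhi := ndu _ _ hi.
have := ler_norm (- u (- M)); have := ler_norm (u M).
have := normr_ge0 (u (- M)); have := normr_ge0 (u M); rewrite normrN.
by rewrite ler_norml => *; apply/andP; split; lra.
Qed.

End bounded_measurable.

(** * Real-valued expectation and Chebyshev's association inequality *)

Section expectation_of_bounded.
Context (R : realType) (d : measure_display) (T : measurableType d).
Variable P : probability T R.
Implicit Types f h : T -> R.

Definition Ex f : R := \int[P]_w f w.

Lemma bm_integrable f : bm f -> P.-integrable setT (EFin \o f).
Proof.
move=> [mf [M fM]]; apply: measurable_bounded_integrable => //.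
  by rewrite (le_lt_trans (probability_le1 P measurableT))// ltry.
exists M; split; first exact: num_real.
by move=> x Mx w _; apply: (le_trans (fM w)); exact: ltW.
Qed.

Lemma expectationE f : bm f -> 'E_P[f]%E = (Ex f)%:E.
Proof.
move=> bf; rewrite unlock /Ex /Rintegral fineK//.
by apply: integrable_fin_num => //; exact: bm_integrable.
Qed.

Lemma ExD f h : bm f -> bm h -> Ex (fun w => f w + h w) = Ex f + Ex h.
Proof. by move=> bf bh; rewrite /Ex RintegralD//; exact: bm_integrable. Qed.

Lemma ExB f h : bm f -> bm h -> Ex (fun w => f w - h w) = Ex f - Ex h.
Proof. by move=> bf bh; rewrite /Ex RintegralB//; exact: bm_integrable. Qed.

Lemma ExZ c f : bm f -> Ex (fun w => c * f w) = c * Ex f.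
Proof. by move=> bf; rewrite /Ex RintegralZl//; exact: bm_integrable. Qed.

Lemma ExN f : bm f -> Ex (fun w => - f w) = - Ex f.
Proof.
move=> bf; rewrite -mulN1r -ExZ//.
by congr Ex; apply/funext => w; rewrite mulN1r.
Qed.

Lemma Ex_cst c : Ex (fun=> c) = c.
Proof. by rewrite /Ex Rintegral_cst// [X in fine X]probability_setT mulr1. Qed.

Lemma Ex_le f h : bm f -> bm h -> (forall w, f w <= h w) -> Ex f <= Ex h.
Proof. by move=> bf bh fh; apply: le_Rintegral => //; exact: bm_integrable. Qed.

Lemma Ex_ge0 f : (forall w, 0 <= f w) -> 0 <= Ex f.
Proof. by move=> f0; exact: Rintegral_ge0. Qed.

Lemma Ex_sum (I : Type) (s : seq I) (Q : pred I) (f : I -> T -> R) :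
  (forall i, Q i -> bm (f i)) ->
  Ex (fun w => \sum_(i <- s | Q i) f i w) = \sum_(i <- s | Q i) Ex (f i).
Proof.
move=> bf; elim: s => [|i s IH].
  by rewrite big_nil -[RHS](Ex_cst 0); congr Ex; apply/funext => w; rewrite big_nil.
rewrite big_cons -IH; case: ifPn => Qi; last first.
  by congr Ex; apply/funext => w; rewrite big_cons (negbTE Qi).
rewrite -ExD; [|exact: bf|exact: bm_sum].
by congr Ex; apply/funext => w; rewrite big_cons Qi.
Qed.

(* The threshold [b] makes [(a Z - b) * (c Z - m)] nonnegative, where [m] is
   the weighted mean of [c Z]. *)
Lemma chebyshev_association (W Z : T -> R) (a c : R -> R) :
  bm W -> bm Z -> (forall w, 0 <= W w) ->
  {homo a : x y / x <= y} -> {homo c : x y / x <= y} ->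
  Ex (fun w => W w * a (Z w)) * Ex (fun w => W w * c (Z w)) <=
  Ex W * Ex (fun w => W w * (a (Z w) * c (Z w))).
Proof.
move=> bW bZ W0 nda ndc.
have baZ := bm_nondecreasing nda bZ; have bcZ := bm_nondecreasing ndc bZ.
have EW0 : 0 <= Ex W by exact: Ex_ge0.
have [M aM] : exists M, forall w, `|a (Z w)| <= M by case: baZ.
have [N cN] : exists N, forall w, `|c (Z w)| <= N by case: bcZ.
have [EW_eq0|EW_gt0] := eqVneq (Ex W) 0.
  have E0 f : bm f -> Ex (fun w => W w * f w) = 0.
    move=> bf; have [_ [K fK]] := bf; apply/eqP; rewrite eq_le.
    have -> : 0 = Ex (fun w => K * W w) by rewrite ExZ// EW_eq0 mulr0.
    rewrite Ex_le//=; [|exact: bmM|by apply: bmM => //; exact: bm_cst|]; last first.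
      by move=> w /=; rewrite mulrC ler_wpM2r// (le_trans (ler_norm _)).
    rewrite (_ : Ex _ = Ex (fun w => - K * W w)); last by rewrite !ExZ// EW_eq0 !mulr0.
    apply: Ex_le; [by apply: bmM => //; exact: bm_cst|exact: bmM|].
    move=> w /=; rewrite [leRHS]mulrC ler_wpM2r//.
    by have := fK w; rewrite ler_norml => /andP[].
  by rewrite EW_eq0 mul0r E0// mul0r.
set m := Ex (fun w => W w * c (Z w)) / Ex W.
pose A := [set a (Z w) | w in [set w | c (Z w) <= m]].
(* When [c (Z w)] never drops to [m] or below, [A] is empty and only [b <= a (Z w)] is required; the
   lower bound [- M] provides it. *)
pose b := if pselect (A !=set0) then sup A else - M.
have abc w : 0 <= (a (Z w) - b) * (c (Z w) - m).
  have hsA : A !=set0 -> has_sup A.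
    move=> A0; split=> //; exists M => _ [u _ <-].
    by rewrite (le_trans (ler_norm _)).
  rewrite /b; case: pselect => A0.
    have [cm|cm] := leP (c (Z w)) m.
      rewrite mulr_le0 ?subr_le0//; apply: ub_le_sup; first by case: (hsA A0).
      by exists w.
    apply: mulr_ge0; rewrite subr_ge0; last exact: ltW.
    apply: ge_sup => // _ [u /= um <-]; apply: nda.
    rewrite leNgt; apply/negP => wu; move: cm; rewrite ltNge => /negP; apply.
    by rewrite (le_trans _ um)// ndc// ltW.
  apply: mulr_ge0.
    by rewrite opprK; have := aM w; rewrite ler_norml -lerBlDr sub0r => /andP[].
  rewrite subr_ge0 leNgt; apply/negP => cm; apply: A0; exists (a (Z w)).
  by exists w => //=; exact: ltW.
have : 0 <= Ex (fun w => W w * ((a (Z w) - b) * (c (Z w) - m))).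
  by apply: Ex_ge0 => w; exact: mulr_ge0.
have -> : Ex (fun w => W w * ((a (Z w) - b) * (c (Z w) - m))) =
    Ex (fun w => W w * (a (Z w) * c (Z w))) - m * Ex (fun w => W w * a (Z w))
    - b * Ex (fun w => W w * c (Z w)) + b * m * Ex W.
  rewrite -!ExZ//; try by do ?[exact: bmM].
  rewrite -!ExB -?ExD//; try by do ?[exact: bm_cst|apply: bmM|apply: bmB].
  by congr Ex; apply/funext => w; ring.
have -> : Ex (fun w => W w * c (Z w)) = m * Ex W by rewrite /m divfK.
have EWp : 0 < Ex W by rewrite lt_def EW_gt0.
set x := Ex _; set y := Ex (fun w => W w * a (Z w)).
move=> h; rewrite mulrA -subr_ge0 (_ : _ - _ = Ex W * (x - m * y)); last by ring.
by apply: mulr_ge0 => //; move: h; rewrite -mulrA; lra.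
Qed.

Lemma association (Z : T -> R) (a c : R -> R) : bm Z ->
  {homo a : x y / x <= y} -> {homo c : x y / x <= y} ->
  Ex (fun w => a (Z w)) * Ex (fun w => c (Z w)) <=
  Ex (fun w => a (Z w) * c (Z w)).
Proof.
move=> bZ nda ndc.
have := chebyshev_association (bm_cst T 1) bZ (fun=> ler01) nda ndc.
rewrite Ex_cst mul1r.
have E1 f : Ex (fun w => 1 * f w) = Ex f.
  by congr Ex; apply/funext => w; rewrite mul1r.
by rewrite !E1.
Qed.

End expectation_of_bounded.

(** * Independence of one entry from the rest of the row, and Fubini *)

Section others.
Context (R : realType) (d : measure_display) (T : measurableType d).
Variables (P : probability T R) (n : nat) (X : nat -> {RV P >-> R}).
Hypothesis indX : independent_rvs [set i : nat | (1 <= i <= n)%N] X.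

Definition others_idx (i : nat) : {fset nat} :=
  [fset j in [seq j <- iota 1 n | j != i]]%fset.

Lemma in_others_idx i j : (j \in others_idx i) = (1 <= j <= n)%N && (j != i).
Proof.
by rewrite /others_idx in_fset /= mem_filter mem_iota add1n ltnS andbC.
Qed.

(* Cylinders over the entries other than [X i]: they generate the information
   carried by the rest of the row. *)
Definition cylinders (i : nat) : set (set T) :=
  [set C | exists2 A : nat -> set R, (forall j, measurable (A j)) &
     C = \bigcap_(j in [set` others_idx i]) (X j @^-1` A j)].

(** Both [others] and [itself] keep the carrier [T] and shrink its sigma-algebra. A function on [T]
    can thus be declared measurable with respect to part of the row without being rewritten as a
    function of those entries. *)
Definition others (i : nat) := g_sigma_algebraType (cylinders i).
Definition itself (i : nat) := g_sigma_algebra_preimageType (X i).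

Lemma cylinders_setI i : setI_closed (cylinders i).
Proof.
move=> _ _ [A mA ->] [B mB ->]; exists (fun j => A j `&` B j).
  by move=> j; exact: measurableI.
rewrite -bigcapI; apply: eq_bigcapr => j _.
by rewrite preimage_setI.
Qed.

Lemma measurable_bigcap_fset (J : {fset nat}) (A : nat -> set R) :
  (forall j, measurable (A j)) ->
  measurable (\bigcap_(j in [set` J]) (X j @^-1` A j)).
Proof.
move=> mA; apply: bigcap_measurableType => j _.
by rewrite -[_ @^-1` _]setTI; exact: measurable_funP.
Qed.

Lemma others_sub i (A : set (others i)) : measurable A ->
  d.-measurable (A : set T).
Proof.
move=> mA; apply: (smallest_sub (@sigma_algebra_measurable _ T)) mA.
by move=> _ [B mB ->]; exact: measurable_bigcap_fset.
Qed.

Lemma itself_sub i (A : set (itself i)) : measurable A ->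
  d.-measurable (A : set T).
Proof. by move=> [B mB <-]; exact: measurable_funP. Qed.

Lemma bm_others i (f : T -> R) : @bm R _ (others i) f -> bm f.
Proof.
move=> [mf [M fM]]; split; last by exists M.
by move=> _ B mB; apply: (@others_sub i); exact: mf.
Qed.

(** Dynkin's argument with [A] fixed: the sets satisfying the product formula form a lambda-system,
    and the cylinders are stable under intersection. On a cylinder the formula compares two
    instances of [indX], with and without the index [i]. *)
Lemma cylinder_indep i (C A : set T) : (1 <= i <= n)%N ->
  measurable (A : set (itself i)) -> measurable (C : set (others i)) ->
  P (A `&` C) = (P A * P C)%E.
Proof.
move=> i1n mA mC; have mA' := itself_sub mA.
pose H := [set C : set T | d.-measurable C /\ P (A `&` C) = (P A * P C)%E].
suff : <<s cylinders i >> `<=` H by move=> /(_ C mC)[].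
have fP B : d.-measurable B -> P B \is a fin_num by exact: fin_num_measure.
apply: lambda_system_subset => //.
- exact: cylinders_setI.
- split.
  + by [].
  + by split => //; rewrite setIT [X in (_ * X)%E]probability_setT mule1.
  + move=> U V VU [mU PU] [mV PV]; split; first exact: measurableD.
    have ltP B : d.-measurable B -> (P B < +oo)%E.
      by move=> mB; rewrite (le_lt_trans (probability_le1 P mB))// ltry.
    have -> : A `&` (U `\` V) = (A `&` U) `\` (A `&` V).
      apply/seteqP; split => w /=; first by move=> [Aw [Uw nV]]; split=> // -[].
      by move=> [[Aw Uw] nAV]; split=> //; split=> // Vw; exact: nAV.
    rewrite !measureD ?ltP//; try exact: measurableI.
    rewrite -setIIr (setIidr VU).
    transitivity (P (A `&` U) - P (A `&` V))%E; first by [].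
    by rewrite PU PV muleBr ?fP// fin_num_adde_defl// fin_numN fP.
  + move=> F ndF HF.
    have mF k : d.-measurable (F k) by case: (HF k).
    have mUF : d.-measurable (\bigcup_k F k) by exact: bigcup_measurable.
    split=> //.
    have c1 : (P A * P (F k))%E @[k --> \oo] --> (P A * P (\bigcup_k F k))%E.
      by apply: cvgeZl; [exact: fP|exact: (@nondecreasing_cvg_mu _ _ _ P F mF mUF ndF)].
    have c2 : P (A `&` F k) @[k --> \oo] --> P (A `&` \bigcup_k F k).
      rewrite setI_bigcupr; apply: (@nondecreasing_cvg_mu _ _ _ P (fun k => A `&` F k)).
      - by move=> k; exact: measurableI.
      - by apply: bigcup_measurable => k _; exact: measurableI.
      - move=> a b ab; apply/subsetPset; apply: setIS.
        by apply/subsetPset; exact: ndF.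
    have /(cvg_lim (@ereal_hausdorff R)) <- := c1.
    have /(cvg_lim (@ereal_hausdorff R)) <- := c2.
    by congr (limn _); apply/funext => k; case: (HF k).
- move=> _ [B mB ->]; split; first exact: measurable_bigcap_fset.
  case: mA => A0 mA0; rewrite setTI => <-.
  set J := others_idx i.
  have iJ : i \notin J by rewrite in_others_idx eqxx andbF.
  have JD : [set` J] `<=` [set j : nat | (1 <= j <= n)%N].
    by move=> j /=; rewrite in_others_idx => /andP[].
  pose B' j := if j == i then A0 else B j.
  have mB' j : measurable (B' j) by rewrite /B'; case: eqP.
  have B'i : B' i = A0 by rewrite /B' eqxx.
  have B'J j : j \in J -> B' j = B j.
    by move=> jJ; rewrite /B' ifN//; apply: contraNN iJ => /eqP <-.
  have := @indX (i |` J)%fset B' _ (fun j _ => mB' j).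
  rewrite (@indX J B JD (fun j _ => mB j)) big_fsetU1//= B'i.
  rewrite (_ : \bigcap_(_ in _) _ = X i @^-1` A0 `&`
      \bigcap_(j in [set` J]) (X j @^-1` B j)); last first.
    rewrite set_fsetU1 bigcap_setU1 B'i; congr (_ `&` _).
    by apply: eq_bigcapr => j /= /B'J ->.
  move=> ->.
    congr (_ * _)%E; rewrite [LHS]big_seq [RHS]big_seq.
    by apply: eq_bigr => j /B'J ->.
  by move=> j /=; rewrite in_fset1U in_others_idx => /orP[/eqP ->//|/andP[]].
Qed.

Lemma itself_measurable_id i :
  measurable_fun setT (fun w : T => (w : itself i)).
Proof. by move=> _ B mB; rewrite setTI; exact: itself_sub mB. Qed.

Lemma others_measurable_id i :
  measurable_fun setT (fun w : T => (w : others i)).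
Proof. by move=> _ B mB; rewrite setTI; exact: others_sub mB. Qed.

Let to_itself i : {mfun T >-> itself i} :=
  HB.pack (fun w : T => (w : itself i))
    (isMeasurableFun.Build _ _ _ _ _ (@itself_measurable_id i)).

Let to_others i : {mfun T >-> others i} :=
  HB.pack (fun w : T => (w : others i))
    (isMeasurableFun.Build _ _ _ _ _ (@others_measurable_id i)).

Lemma diag_measurable i :
  measurable_fun setT (fun w : T => (w, w) : itself i * others i).
Proof.
by apply/measurable_fun_pairP; split;
  [exact: itself_measurable_id|exact: others_measurable_id].
Qed.

Let diag i : {mfun T >-> (itself i * others i)%type} :=
  HB.pack (fun w : T => (w, w) : itself i * others i)
    (isMeasurableFun.Build _ _ _ _ _ (@diag_measurable i)).

Let bm_section i (F : itself i * others i -> R) w :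
  bm F -> bm (fun w' : T => F (w', w)).
Proof.
move=> [mF [M FM]]; split; last by exists M.
apply: (measurableT_comp mF); apply/measurable_fun_pairP; split.
  exact: itself_measurable_id.
exact: measurable_cst.
Qed.

Let integrable_prod i (F : itself i * others i -> R) : bm F ->
  (distribution P (to_itself i) \x distribution P (to_others i))%E.-integrable
    setT (EFin \o F).
Proof.
move=> [mF [M FM]]; apply: measurable_bounded_integrable => //; last first.
  exists M; split; first exact: num_real.
  by move=> x Mx w _; apply: (le_trans (FM w)); exact: ltW.
have : ((distribution P (to_itself i) \x distribution P (to_others i))%E
    (setT `*` setT) < +oo)%E.
  by rewrite product_measure1E// [X in (X * _)%E]probability_setT
    [X in (_ * X)%E]probability_setT mule1 ltry.
by rewrite setXTT.
Qed.

Let fubini_GE i (F : itself i * others i -> R) w : bm F ->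
  fubini_G (distribution P (to_itself i)) (EFin \o F) w =
  (Ex P (fun w' => F (w', w)))%:E.
Proof.
move=> bF; have [mF _] := bF.
rewrite /fubini_G (@integral_distribution _ _ _ _ _ P (to_itself i)
  (fun x => (EFin \o F) (x, w)))//.
- rewrite /Ex /Rintegral fineK//; apply: integrable_fin_num => //.
  by apply: bm_integrable; exact: bm_section.
- apply/measurable_EFinP; apply: (measurableT_comp mF).
  exact: pair2_measurable.
- by apply: bm_integrable; exact: bm_section.
Qed.

Lemma bm_Ex_freeze i (F : itself i * others i -> R) : bm F ->
  @bm R _ (others i) (fun w => Ex P (fun w' => F (w', w))).
Proof.
move=> bF; have [mF [M FM]] := bF; split; last first.
  exists M => w; rewrite -(Ex_cst P M).
  have bs := bm_section w bF.
  apply: (le_trans (le_normr_Rintegral _ _)) => //; first exact: bm_integrable.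
  by apply: Ex_le => //; [exact: bm_norm|exact: bm_cst].
apply/measurable_EFinP.
rewrite (_ : _ \o _ = fubini_G (distribution P (to_itself i)) (EFin \o F)).
  exact: measurable_fubini_G (integrable_prod bF).
by apply/funext => w /=; rewrite fubini_GE.
Qed.

(** This replaces conditioning on the other entries. By [cylinder_indep] the law of [w |-> (w, w)]
    on [itself X i * others n X i] is the product of its marginals, so Fubini applies. *)
Lemma Ex_freeze i (F : itself i * others i -> R) : (1 <= i <= n)%N -> bm F ->
  Ex P (fun w => F (w, w)) = Ex P (fun w => Ex P (fun w' => F (w', w))).
Proof.
move=> i1n bF; have [mF [M FM]] := bF.
pose P1 := distribution P (to_itself i); pose P2 := distribution P (to_others i).
have bFd : bm (fun w : T => F (w, w)).
  split; first exact: (measurableT_comp mF (@diag_measurable i)).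
  by exists M.
have mEF : measurable_fun setT (EFin \o F) by exact/measurable_EFinP.
have iF : (P1 \x P2)%E.-integrable setT (EFin \o F) by exact: integrable_prod.
have e1 : (\int[P]_w (F (w, w))%:E)%E = (\int[P1 \x P2]_z (F z)%:E)%E.
  rewrite -(@integral_distribution _ _ _ _ _ P (diag i) (EFin \o F))//; last first.
    exact: bm_integrable.
  apply: eq_measure_integral => A mA _; apply/esym.
  apply: (@product_measure_unique _ _ _ _ _ P1 P2 (distribution P (diag i))) => //.
  by move=> B C mB mC; exact: (cylinder_indep i1n mB mC).
rewrite /Ex /Rintegral e1 -(@integral21_prod_meas1 _ _ _ _ _ P1 P2 (EFin \o F))//.
congr fine.
rewrite (@integral_distribution _ _ _ _ _ P (to_others i))//.
- by apply: eq_integral => w _ /=; rewrite fubini_GE.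
- exact: (measurable_fubini_G iF).
- rewrite (_ : _ \o _ = EFin \o (fun w => Ex P (fun w' => F (w', w)))).
    by apply: bm_integrable; apply: (@bm_others i); exact: bm_Ex_freeze.
  by apply/funext => w /=; rewrite fubini_GE.
Qed.

Lemma bm_fst i (Y : itself i -> R) :
  bm Y -> bm (fun z : itself i * others i => Y z.1).
Proof.
by move=> [mY [M YM]]; split; [exact: (measurableT_comp mY)|exists M => z].
Qed.

Lemma bm_snd i (Y : others i -> R) :
  bm Y -> bm (fun z : itself i * others i => Y z.2).
Proof.
by move=> [mY [M YM]]; split; [exact: (measurableT_comp mY)|exists M => z].
Qed.

Lemma bm_itself i (f : T -> R) : @bm R _ (itself i) f -> bm f.
Proof.
move=> [mf [M fM]]; split; last by exists M.
by move=> _ B mB; apply: (@itself_sub i); exact: mf.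
Qed.

Lemma Ex_indep i (U Y : T -> R) : (1 <= i <= n)%N ->
  @bm R _ (itself i) U -> @bm R _ (others i) Y ->
  Ex P (fun w => Y w * U w) = Ex P Y * Ex P U.
Proof.
move=> i1n bU bY.
pose F (z : itself i * others i) := Y z.2 * U z.1.
have bF : bm F by apply: bmM; [exact: bm_snd|exact: bm_fst].
rewrite (Ex_freeze i1n bF) /F.
rewrite /= mulrC -ExZ; last exact: bm_others bY.
congr Ex; apply/funext => w; rewrite ExZ 1?mulrC//; exact: bm_itself bU.
Qed.

End others.

(** * From the probabilistic estimates to the asymptotics, by real analysis alone *)

Section barrier_numerics.
Context (R : realType).
Variables (n : nat) (r gs K delta : R).
(* To be instantiated by [alive_prob], [elapsed_variance], [step_variance],
   [scale], [barrier_mean], [layer], [shifted_mean] and [overshoot]. *)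
Variables (p t s2 scale : nat -> R) (V : R -> nat -> R).
Variables (layer : R -> nat -> nat -> R -> R) (M : R -> nat -> R) (En : R).
Local Notation b := scale.
Local Notation eps := (r + gs).
Hypothesis r0 : 0 <= r.
Hypothesis gs0 : 0 <= gs.
Hypothesis K2 : 2 <= K.
Hypothesis delta_gt0 : 0 < delta.
Hypothesis r_delta : r ^+ 2 <= delta.
Hypothesis delta_le1 : delta <= 1.
Hypothesis tn1 : t n = 1.
Hypothesis t0E : t 0 = 0.
Hypothesis t_rec : forall k, t k.+1 = t k + s2 k.+1.
Hypothesis s2_ge0 : forall i, 0 <= s2 i.
Hypothesis s2_le : forall i, (1 <= i <= n)%N -> s2 i <= r ^+ 2.
Hypothesis p_ge0 : forall k, 0 <= p k.
Hypothesis p_le : forall j k, (j <= k)%N -> (k <= n)%N -> p k <= p j.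
Hypothesis t_ge0 : forall k, 0 <= t k.
Hypothesis t_le1 : forall k, (k <= n)%N -> t k <= 1.
Hypothesis scale_gt0 : forall k, (k <= n)%N -> 0 < b k.
Hypothesis scale2 : forall k, (k <= n)%N -> b k ^+ 2 = 2 * (1 - t k + delta).
Hypothesis overshoot_ge0 : 0 <= En.
Hypothesis p_le_overshoot : forall m (B : R), (m <= n)%N -> 0 < B -> B ^+ 2 = t m ->
  24 * (r + gs) <= B -> p m * B <= 4 * En.
Hypothesis barrier_step : forall sg k, sg = 1 \/ sg = -1 -> (k < n)%N ->
  sg * V sg k.+1 <= sg * V sg k +
    96 * K * r * s2 k.+1 / b k.+1 ^+ 3 * layer sg k k (b k.+1).
Hypothesis layer_le_p : forall sg j k a, (j <= n)%N -> (k <= n)%N -> layer sg j k a <= p j.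
Hypothesis layer_le : forall sg i j k a, (i <= j)%N -> (j <= n)%N -> (k <= n)%N ->
  layer sg j k a <= layer sg i k a.
Hypothesis layer_anticoncentration : forall sg j l a, (j <= l)%N -> (l <= n)%N ->
  0 < a -> r <= a -> (t l - t j) * layer sg j l a <= 18 * a * p j.
Hypothesis barrier_end : forall sg, sg = 1 \/ sg = -1 ->
  sg * p n <= sg * V sg n + K * layer sg n n (b n).
Hypothesis barrier_start : forall sg m, sg = 1 \/ sg = -1 -> (m <= n)%N ->
  `|V sg m - 2 / Num.sqrt pi / b m * M sg m| <=
  8 * K / b m ^+ 3 * (16 * t m * En + 108 * eps ^+ 3 * p m).
Hypothesis mean_alive_shift_le : forall sg m, sg = 1 \/ sg = -1 -> (m <= n)%N ->
  `|M sg m - En| <= 2 * eps * p m.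

Let K0 : 0 <= K. Proof. exact: le_trans K2. Qed.

Let le_of_sqr (x y : R) : 0 <= x -> 0 <= y -> x ^+ 2 <= y ^+ 2 -> x <= y.
Proof. by move=> x0 y0; rewrite ler_pXn2r ?nnegrE. Qed.

(** As long as the scale is at least 1 the third derivative is harmless, and bounding [layer] by
    [p m] is enough. *)
Lemma barrier_early sg m j : sg = 1 \/ sg = -1 -> (m <= j)%N -> (j <= n)%N ->
  1 <= b j -> sg * V sg j <= sg * V sg m + 96 * K * r * p m * (t j - t m).
Proof.
move=> sg1; elim: j => [|j IH] mj jn bj1.
  by move: mj; rewrite leqn0 => /eqP ->; rewrite subrr mulr0 addr0.
move: mj; rewrite leq_eqVlt => /predU1P[->|]; last rewrite ltnS => mj.
  by rewrite subrr mulr0 addr0.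
have jn' := ltnW jn; have hd := delta_gt0.
have bj : 1 <= b j.
  apply: (le_trans bj1); apply: le_of_sqr; try by rewrite ltW// scale_gt0.
  by rewrite !scale2// t_rec; have := s2_ge0 j.+1; lra.
apply: (le_trans (barrier_step sg1 jn)).
have h := IH mj jn' bj.
have L0 : layer sg j j (b j.+1) <= p m.
  by apply: (le_trans (layer_le_p _ _ jn' jn')); exact: p_le.
have c0 : 0 <= 96 * K * r * s2 j.+1.
  by apply: mulr_ge0 => //; rewrite mulr_ge0// mulr_ge0.
have b3 : (b j.+1 ^+ 3)^-1 <= 1.
  by rewrite invf_le1 ?exprn_gt0 ?scale_gt0// exprn_ege1.
have h2 : 96 * K * r * s2 j.+1 / b j.+1 ^+ 3 * layer sg j j (b j.+1) <=
    96 * K * r * s2 j.+1 * p m.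
  apply: (@le_trans _ _ (96 * K * r * s2 j.+1 / b j.+1 ^+ 3 * p m)).
    apply: ler_wpM2l => //; apply: mulr_ge0 => //.
    by rewrite invr_ge0 exprn_ge0// ltW// scale_gt0.
  by apply: ler_wpM2r => //; rewrite -[leRHS]mulr1; apply: ler_wpM2l.
rewrite t_rec; lra.
Qed.

(** Anticoncentration bounds [(t k - t j) * layer] by [18 * a * p j] and is useless when [t k - t j]
    is small. The trivial bound gives [a ^ 2 / 2 * layer <= a * p j]. The two weights add up to at
    least [5/6 - 1/3 = 1/2], whence [38 = 2 * (18 + 1)]. *)
Lemma layer_late sg j k a : (j <= k)%N -> (k <= n)%N -> t j <= 3^-1 ->
  0 < a -> 2 * r ^+ 2 <= a ^+ 2 -> a ^+ 2 <= 4 ->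
  1 <= t k + a ^+ 2 / 2 + 6^-1 -> layer sg k k a <= 38 * a * p j.
Proof.
move=> jk kn tj a0 ra a2 tka.
have jn := leq_trans jk kn.
apply: (le_trans (layer_le sg a jk kn kn)).
have ra' : r <= a.
  apply: le_of_sqr => //; first exact: ltW.
  by have := sqr_ge0 r; lra.
have h1 := layer_anticoncentration sg jk kn a0 ra'.
have h2 := layer_le_p sg a jn kn.
have a2' : a <= 2.
  by apply: le_of_sqr => //; [exact: ltW|lra].
set L := layer sg j k a in h1 h2 *.
have h3 : a ^+ 2 / 2 * L <= a * p j.
  apply: (@le_trans _ _ (a ^+ 2 / 2 * p j)).
    by apply: ler_wpM2l; rewrite // divr_ge0// sqr_ge0.
  apply: ler_wpM2r => //; nra.
have [L0|L0] := leP L 0.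
  by apply: (le_trans L0); rewrite mulr_ge0// mulr_ge0// ltW.
have h4 : 2^-1 * L <= (t k - t j + a ^+ 2 / 2) * L.
  by rewrite ler_pM2r//; lra.
lra.
Qed.

Let b_sq_bounds k : (k <= n)%N -> 2 * r ^+ 2 <= b k ^+ 2 <= 4.
Proof.
move=> kn; rewrite scale2//; have h := t_le1 kn; have h2 := t_ge0 k.
have h3 := r_delta; have h4 := delta_le1.
by apply/andP; split; lra.
Qed.

(** By [layer_late] a step costs a multiple of [r * s2 / b ^ 2] instead of [r * s2 / b ^ 3]. Since
    [b ^ 2] decreases by [2 * s2] in a step, these costs telescope into a difference of
    logarithms. *)
Lemma barrier_late sg j l : sg = 1 \/ sg = -1 -> (j <= l)%N -> (l <= n)%N ->
  t j <= 3^-1 -> r ^+ 2 <= 6^-1 ->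
  sg * V sg l <= sg * V sg j +
    96 * K * r * 38 * p j * (ln (b j ^+ 2) - ln (b l ^+ 2)).
Proof.
move=> sg1 jl lln tj r6; elim: l => [|l IH] in jl lln *.
  by move: jl; rewrite leqn0 => /eqP ->; rewrite subrr mulr0 addr0.
move: jl; rewrite leq_eqVlt => /predU1P[->|]; last rewrite ltnS => jl.
  by rewrite subrr mulr0 addr0.
have lln' := ltnW lln.
have /andP[b1 b2] := b_sq_bounds lln.
have B0 := scale_gt0 lln; have B0' := scale_gt0 lln'.
have sl := @s2_le l.+1 lln; have sl0 := s2_ge0 l.+1.
have hd := delta_gt0.
(* The walk is taken at time [l] but the scale at time [l.+1]: [t l + b l.+1 ^ 2 / 2] may fall short
   of 1 by [s2 l.+1 <= r ^ 2], which the slack [1/6] covers. *)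
have hL : layer sg l l (b l.+1) <= 38 * b l.+1 * p j.
  by apply: layer_late => //; rewrite scale2// t_rec; lra.
apply: (le_trans (barrier_step sg1 lln)).
have h := IH jl lln'.
have c0 : 0 <= 96 * K * r by rewrite mulr_ge0// mulr_ge0.
have hln : s2 l.+1 / b l.+1 ^+ 2 <= ln (b l ^+ 2) - ln (b l.+1 ^+ 2).
  have bb : b l ^+ 2 = b l.+1 ^+ 2 + 2 * s2 l.+1 by rewrite !scale2// t_rec; ring.
  have p1 : 0 < b l ^+ 2 by rewrite exprn_gt0.
  have p2 : 0 < b l.+1 ^+ 2 by rewrite exprn_gt0.
  have h1 : ln (b l.+1 ^+ 2 / b l ^+ 2) <= b l.+1 ^+ 2 / b l ^+ 2 - 1.
    have := @le_ln1Dx R (b l.+1 ^+ 2 / b l ^+ 2 - 1).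
    rewrite addrCA subrr addr0; apply.
    by rewrite ltrBrDr addNr divr_gt0.
  rewrite ln_div ?posrE// in h1.
  have h2 : b l.+1 ^+ 2 / b l ^+ 2 - 1 = - (2 * s2 l.+1 / b l ^+ 2).
    by rewrite (_ : b l.+1 ^+ 2 = b l ^+ 2 - 2 * s2 l.+1);
      [field; rewrite gt_eqF|rewrite bb; ring].
  have h3 : s2 l.+1 / b l.+1 ^+ 2 <= 2 * s2 l.+1 / b l ^+ 2.
    rewrite ler_pdivrMr// mulrAC ler_pdivlMr// bb.
    nra.
  lra.
have h2 : 96 * K * r * s2 l.+1 / b l.+1 ^+ 3 * layer sg l l (b l.+1) <=
    96 * K * r * 38 * p j * (s2 l.+1 / b l.+1 ^+ 2).
  apply: (@le_trans _ _ (96 * K * r * s2 l.+1 / b l.+1 ^+ 3 * (38 * b l.+1 * p j))).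
    apply: ler_wpM2l => //; apply: mulr_ge0; first exact: mulr_ge0.
    by rewrite invr_ge0 exprn_ge0// ltW.
  by rewrite le_eqVlt; apply/orP; left; apply/eqP; field; rewrite gt_eqF.
have h3 : 96 * K * r * 38 * p j * (s2 l.+1 / b l.+1 ^+ 2) <=
    96 * K * r * 38 * p j * (ln (b l ^+ 2) - ln (b l.+1 ^+ 2)).
  by apply: ler_wpM2l => //; rewrite mulr_ge0// mulr_ge0.
move: h h2 h3; rewrite !mulrBr; lra.
Qed.

Lemma first_passage_of_variance c : 0 < c -> c <= 1 ->
  exists m, [/\ (m <= n)%N, c <= t m, t m <= c + r ^+ 2 &
    forall k, c <= t k -> (m <= k)%N].
Proof.
move=> c0 c1.
have ex : exists m, c <= t m by exists n; rewrite tn1.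
case: (ex_minnP ex) => m cm mmin; exists m.
have mn : (m <= n)%N by apply: mmin; rewrite tn1.
split=> //; case: m => [|m] in cm mmin mn *.
  by rewrite t0E addr_ge0 ?sqr_ge0// ltW.
rewrite t_rec lerD ?s2_le//.
by have [//|/ltW/mmin] := leP (t m) c; rewrite ltnn.
Qed.

(** The cube root of [eps]: in terms of it every error is an integral power. *)
Variable kappa : R.
Hypothesis kappa_gt0 : 0 < kappa.
Hypothesis kappa_small : kappa <= 24^-1.
Hypothesis eps_kappa : eps = kappa ^+ 3.
Hypothesis delta_kappa : delta = kappa ^+ 4.

Let k2 : kappa ^+ 2 <= 24^-1 * kappa.
Proof. by rewrite expr2 ler_wpM2r// ltW. Qed.

Let scale_end : b n <= 2 * kappa ^+ 2.
Proof.
apply: le_of_sqr; first by rewrite ltW// scale_gt0.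
  by rewrite mulr_ge0// sqr_ge0.
rewrite scale2// tn1 delta_kappa exprMn -exprM.
have : 0 <= kappa ^+ 4 by rewrite exprn_ge0// ltW.
lra.
Qed.

(** The ratio of squared scales is at most [(2 / kappa) ^ 4]. The crude bound [ln x <= x] suffices,
    because this quantity is multiplied by [r <= kappa ^ 3]. *)
Let log_scale j : (j <= n)%N -> ln (b j ^+ 2) - ln (b n ^+ 2) <= 8 / kappa.
Proof.
move=> jn; have /andP[_ bj] := b_sq_bounds jn.
have bj0 : 0 < b j ^+ 2 by rewrite exprn_gt0// scale_gt0.
have bn0 : 0 < b n ^+ 2 by rewrite exprn_gt0// scale_gt0.
have bnE : b n ^+ 2 = 2 * kappa ^+ 4 by rewrite scale2// tn1 delta_kappa subrr add0r.
rewrite -ln_div ?posrE//.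
have k4 : 0 < kappa ^+ 4 by rewrite exprn_gt0.
have q0 : 0 < 2 / kappa by rewrite divr_gt0.
apply: (@le_trans _ _ (ln ((2 / kappa) ^+ 4))).
  have h1 : 0 < b j ^+ 2 / b n ^+ 2 by exact: divr_gt0.
  have h2 : 0 < (2 / kappa) ^+ 4 by rewrite exprn_gt0.
  rewrite ler_ln ?posrE// ler_pdivrMr// bnE.
  rewrite (_ : (2 / kappa) ^+ 4 * (2 * kappa ^+ 4) = 32); first by lra.
  by field; rewrite gt_eqF.
rewrite lnXn// -[ln _ *+ 4]mulr_natl.
rewrite (_ : 8 / kappa = 4%:R * (2 / kappa)); last by field; rewrite gt_eqF.
apply: ler_wpM2l => //.
have := @le_ln1Dx R (2 / kappa - 1); rewrite addrCA subrr addr0 => h.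
have := h _; rewrite ltrBrDr addNr => /(_ q0); lra.
Qed.

(** The summands of the constant are, in order, the errors [F1] to [F5]: the terminal layer, the
    late steps, the early steps, the cubic remainder of [erf] at the starting time, and the
    replacement of [M sg m] and [b m] by [En] and [sqrt 2]. *)
Lemma asymptotics_from_estimates :
  `|p n - Num.sqrt (2 / pi) * En| <=
  (K * (38 * 24 + 96 * 38 * 96 + 96 * 4 + 8 * (32 + 108 * 4)) + 24) *
    (kappa ^+ 2 * En).
Proof.
have kk := k2; have k0 := kappa_gt0; have ks := kappa_small.
have hr := r0; have hgs := gs0; have hE := overshoot_ge0; have hd := delta_gt0.
have r_eps : r <= kappa ^+ 3 by rewrite -eps_kappa; lra.
have k20 : 0 < kappa ^+ 2 by rewrite exprn_gt0.
have k21 : kappa ^+ 2 <= 8^-1 by lra.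
have k3 : kappa ^+ 3 <= 72^-1.
  by rewrite exprS; have := ler_pM (ltW k0) (ltW k20) ks k21; lra.
have r2k : r ^+ 2 <= kappa ^+ 2.
  rewrite lerXn2r ?nnegrE ?(ltW k0)// (le_trans r_eps)// exprS ler_piMr ?(ltW k0)//; lra.
have [m [mn m1 m2 mmin]] : exists m, [/\ (m <= n)%N, kappa ^+ 2 <= t m,
    t m <= kappa ^+ 2 + r ^+ 2 & forall k, kappa ^+ 2 <= t k -> (m <= k)%N].
  by apply: first_passage_of_variance => //; lra.
(* The time [j] separates the two regimes. It is early enough for [1 <= b j] and [t j <= 3^-1], and
   late enough for [sqrt (t j) >= 3^-1], hence [p j <= 12 * En]. *)
have [j [jn j1 j2 jmin]] : exists m, [/\ (m <= n)%N, 8^-1 <= t m,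
    t m <= 8^-1 + r ^+ 2 & forall k, 8^-1 <= t k -> (m <= k)%N].
  by apply: first_passage_of_variance => //; lra.
have mj : (m <= j)%N by apply: mmin; lra.
have tm2 : t m <= 2 * kappa ^+ 2 by lra.
set w := kappa ^+ 2 * En.
have w0 : 0 <= w by rewrite mulr_ge0// ltW.
have pm : kappa * p m <= 4 * En.
  have st : Num.sqrt (t m) ^+ 2 = t m by rewrite sqr_sqrtr.
  have s1 : kappa <= Num.sqrt (t m).
    by apply: le_of_sqr; [exact: ltW|exact: sqrtr_ge0|rewrite st].
  have s0 : 0 < Num.sqrt (t m) by exact: lt_le_trans s1.
  apply: (le_trans _ (p_le_overshoot mn s0 st _)).
    by rewrite mulrC ler_wpM2l.
  apply: le_trans s1; rewrite eps_kappa exprS; nra.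
have pj : p j <= 12 * En.
  have st : Num.sqrt (t j) ^+ 2 = t j by rewrite sqr_sqrtr.
  have s1 : 3^-1 <= Num.sqrt (t j).
    by apply: le_of_sqr; rewrite ?invr_ge0 ?sqrtr_ge0// st; lra.
  have s0 : 0 < Num.sqrt (t j) by apply: lt_le_trans s1; rewrite invr_gt0.
  have h1 := p_le_overshoot jn s0 st.
  have h2 := ler_wpM2l (p_ge0 j) s1.
  have := h1 _; rewrite eps_kappa; lra.
have epm : eps * p m <= 4 * w.
  by rewrite eps_kappa /w; have := ler_wpM2l (ltW k20) pm; lra.
have bge1 i : (i <= n)%N -> t i <= 2^-1 -> 1 <= b i.
  move=> iN ti; apply: le_of_sqr => //; first by rewrite ltW// scale_gt0.
  by rewrite scale2//; lra.
have bm1 : 1 <= b m by apply: bge1 => //; lra.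
have bj1 : 1 <= b j by apply: bge1 => //; lra.
have p0 := p_ge0 m.
have c0 : 0 <= 2 / Num.sqrt pi :> R by rewrite divr_ge0.
have c2 : 2 / Num.sqrt pi <= 2 :> R.
  have : 1 <= Num.sqrt pi :> R.
    by rewrite -[leLHS]sqrtr1 ler_sqrt ?pi_ge0// (le_trans _ (pi_ge2 R))// ler1n.
  by move=> h; rewrite ler_pdivrMr ?ler_peMr// (lt_le_trans ltr01).
(* The sign 1 yields the upper bound on [p n] and the sign -1 the lower one. *)
have F sg : sg = 1 \/ sg = -1 -> sg * p n <= sg * (Num.sqrt (2 / pi) * En) +
    (K * (38 * 24 + 96 * 38 * 96 + 96 * 4 + 8 * (32 + 108 * 4)) + 24) * w.
  move=> sg1.
  have F1 : K * layer sg n n (b n) <= K * (38 * 24) * w.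
    rewrite -mulrA; apply: ler_wpM2l => //.
    have /andP[h1 h2] := b_sq_bounds (leqnn n).
    have hl : layer sg n n (b n) <= 38 * b n * p j.
      apply: layer_late; rewrite ?tn1//; try lra; first exact: scale_gt0.
    apply: (le_trans hl).
    have : b n * p j <= 2 * kappa ^+ 2 * (12 * En).
      by apply: ler_pM => //; rewrite ltW// scale_gt0.
    rewrite /w; lra.
  have F2 : 96 * K * r * 38 * p j * (ln (b j ^+ 2) - ln (b n ^+ 2)) <=
      K * (96 * 38 * 96) * w.
    have h := log_scale jn.
    apply: (@le_trans _ _ (96 * K * r * 38 * p j * (8 / kappa))).
      by apply: ler_wpM2l => //; rewrite mulr_ge0// mulr_ge0// mulr_ge0// mulr_ge0.
    have h1 : r * p j <= kappa ^+ 3 * (12 * En) by exact: ler_pM.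
    have h2 : r * p j * (8 / kappa) <= 96 * w.
      apply: (le_trans (ler_wpM2r _ h1)); first by rewrite divr_ge0// ltW.
      by rewrite /w le_eqVlt; apply/orP; left; apply/eqP; field; rewrite gt_eqF.
    have h3 : 0 <= K * (96 * 38) by rewrite mulr_ge0.
    by have := ler_wpM2l h3 h2; lra.
  have F3 : 96 * K * r * p m * (t j - t m) <= K * (96 * 4) * w.
    have h1 : r * p m <= 4 * w.
      apply: le_trans epm; apply: ler_wpM2r => //; lra.
    have h2 : r * p m * (t j - t m) <= r * p m.
      by rewrite ler_piMr ?mulr_ge0//; have := t_le1 jn; have := t_ge0 m; lra.
    have h3 : 0 <= K * 96 by rewrite mulr_ge0.
    by have := ler_wpM2l h3 (le_trans h2 h1); lra.
  have F4 : 8 * K / b m ^+ 3 * (16 * t m * En + 108 * eps ^+ 3 * p m) <=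
      K * (8 * (32 + 108 * 4)) * w.
    have h1 : 16 * t m * En <= 32 * w.
      by have := ler_wpM2r hE tm2; rewrite /w; lra.
    have h2 : 108 * eps ^+ 3 * p m <= 108 * 4 * w.
      have e0 : 0 <= eps by rewrite addr_ge0.
      have e2 : eps <= 1 by rewrite eps_kappa; lra.
      have e1 : eps ^+ 3 <= eps by rewrite exprS ler_piMr// exprn_ile1.
      have := le_trans (ler_wpM2r p0 e1) epm; lra.
    have h3 : 8 * K / b m ^+ 3 <= 8 * K.
      rewrite ler_piMr ?mulr_ge0//.
      by rewrite invf_le1 ?exprn_gt0 ?scale_gt0// exprn_ege1.
    have h4 : 16 * t m * En + 108 * eps ^+ 3 * p m <= (32 + 108 * 4) * w by lra.
    apply: (@le_trans _ _ (8 * K * ((32 + 108 * 4) * w))); last by lra.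
    apply: ler_pM => //.
      by apply: mulr_ge0; [exact: mulr_ge0|rewrite invr_ge0 exprn_ge0// ltW// scale_gt0].
    apply: addr_ge0; apply: mulr_ge0 => //; apply: mulr_ge0 => //.
    by rewrite exprn_ge0//; lra.
  have F5 : `|2 / Num.sqrt pi / b m * M sg m - Num.sqrt (2 / pi) * En| <= 24 * w.
    have h1 : `|M sg m - En| <= 8 * w.
      apply: (le_trans (mean_alive_shift_le sg1 mn)); lra.
    have r2 : 1 <= Num.sqrt 2 :> R by rewrite -[leLHS]sqrtr1 ler_sqrt// ler1n.
    have r22 : Num.sqrt 2 ^+ 2 = 2 :> R by rewrite sqr_sqrtr.
    have B0 := scale_gt0 mn.
    have h2 : `|(b m)^-1 - (Num.sqrt 2)^-1| <= 4 * kappa ^+ 2.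
      have r20 : 0 < Num.sqrt 2 :> R by exact: lt_le_trans r2.
      rewrite (_ : _ - _ = (Num.sqrt 2 ^+ 2 - b m ^+ 2) /
        (b m * Num.sqrt 2 * (Num.sqrt 2 + b m))); last first.
        by field; rewrite !gt_eqF// addr_gt0.
      have d1 : 1 <= b m * Num.sqrt 2 * (Num.sqrt 2 + b m).
        have q1 : 1 <= b m * Num.sqrt 2 by rewrite mulr_ege1.
        by rewrite mulr_ege1//; lra.
      rewrite normrM normfV (ger0_norm (le_trans ler01 d1)) ler_pdivrMr ?(lt_le_trans ltr01)//.
      have d2 : `|Num.sqrt 2 ^+ 2 - b m ^+ 2| <= 4 * kappa ^+ 2.
        rewrite r22 scale2// delta_kappa ler_norml.
        have q1 : kappa ^+ 4 <= kappa ^+ 2.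
          by rewrite (exprD _ 2 2) ler_piMr// ?(ltW k20)//; lra.
        have q2 : 0 <= kappa ^+ 4 by rewrite exprn_ge0// ltW.
        by have := t_ge0 m; move=> q3; apply/andP; split; lra.
      by apply: (le_trans d2); rewrite ler_peMr// mulr_ge0// ltW.
    have h3 : Num.sqrt (2 / pi) = 2 / Num.sqrt pi / Num.sqrt 2 :> R.
      have pp : 0 < Num.sqrt pi :> R by rewrite sqrtr_gt0 pi_gt0.
      rewrite sqrtrM// sqrtrV ?pi_ge0// -{2}r22; field.
      by rewrite !gt_eqF// (lt_le_trans ltr01).
    rewrite h3 (_ : _ - _ = 2 / Num.sqrt pi * ((b m)^-1 * (M sg m - En) +
      ((b m)^-1 - (Num.sqrt 2)^-1) * En)); last by ring.
    rewrite normrM (ger0_norm c0).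
    have h4 : `|(b m)^-1 * (M sg m - En) + ((b m)^-1 - (Num.sqrt 2)^-1) * En| <= 12 * w.
      apply: (le_trans (ler_normD _ _)); rewrite !normrM normfV (gtr0_norm B0) (ger0_norm hE).
      have q1 : (b m)^-1 * `|M sg m - En| <= `|M sg m - En|.
        by rewrite ler_piMl// invf_le1.
      have q2 := ler_wpM2r hE h2.
      by move: q1 q2 h1; rewrite /w; lra.
    by have := ler_pM c0 (normr_ge0 _) c2 h4; lra.
  have G1 := barrier_end sg1.
  have G2 : sg * V sg n <= sg * V sg j +
    96 * K * r * 38 * p j * (ln (b j ^+ 2) - ln (b n ^+ 2)).
    by apply: barrier_late => //; lra.
  have G3 := barrier_early sg1 mj jn bj1.
  have G4 := le_trans (barrier_start sg1 mn) F4.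
  have G5 : sg * V sg m <= sg * (Num.sqrt (2 / pi) * En) + K * (8 * (32 + 108 * 4)) * w + 24 * w.
    move: G4 F5; set A := 2 / _ / _ * M sg m; set c := Num.sqrt _ * En; set v := V sg m.
    set C := K * _ * w; rewrite ler_norml => /andP[x1 x2].
    rewrite ler_norml => /andP[x3 x4].
    by case: sg1 => ->; lra.
  move: F1 F2 F3 G1 G2 G3 G5; lra.
rewrite ler_norml.
have := F 1 (or_introl erefl); have := F (-1) (or_intror erefl).
by move=> h1 h2; apply/andP; split; lra.
Qed.

End barrier_numerics.

Ltac bm_auto := repeat first
  [ assumption | apply: bm_cst | apply: bmD | apply: bmN | apply: bmM
  | apply: bmX | apply: bm_norm | apply: bm_max ].

(** * The walk with everywhere bounded entries, and its survival *)

Section walk.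
Context (R : realType) (d : measure_display) (T : measurableType d).
Variables (P : probability T R) (n : nat) (X : nat -> {RV P >-> R}).
Variables (g : nat -> R) (r gs : R).
Hypothesis indX : independent_rvs [set i : nat | (1 <= i <= n)%N] X.
Hypothesis Xr : forall i w, (1 <= i <= n)%N -> `|X i w| <= r.
Hypothesis EX0 : forall i, (1 <= i <= n)%N -> Ex P (X i) = 0.
Hypothesis ggs : forall k, (1 <= k <= n)%N -> `|g k| <= gs.
Hypothesis r0 : 0 <= r.
Hypothesis gs0 : 0 <= gs.

Notation E := (Ex P).

Local Notation S := (partial_sum (fun i => X i : T -> R)).

(** The indicator of survival as a real-valued product: its one-step recursion and its measurability
    in the first [k] entries are then immediate. [aliveE_survival] identifies it with the event
    [survival]. *)
Fixpoint alive (k : nat) (w : T) : R :=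
  if k is k'.+1 then alive k' w * (g k < S k w)%R%:R else 1.

Local Notation J := alive.

Definition step_variance i := E (fun w => X i w ^+ 2).
Local Notation s2 := step_variance.

Definition elapsed_variance m := \sum_(1 <= i < m.+1) s2 i.
Local Notation t := elapsed_variance.

Lemma S0 w : S 0 w = 0.
Proof. by rewrite /partial_sum big_geq. Qed.

Lemma S_rec k w : S k.+1 w = S k w + X k.+1 w.
Proof. by rewrite /partial_sum big_nat_recr. Qed.

Lemma t_rec k : t k.+1 = t k + s2 k.+1.
Proof. by rewrite /t big_nat_recr. Qed.

Lemma s2_ge0 i : 0 <= s2 i.
Proof. by apply: Ex_ge0 => w; exact: sqr_ge0. Qed.

Lemma bm_X i : (1 <= i <= n)%N -> bm (X i : T -> R).
Proof. by move=> i1n; split=> //; exists r => w; exact: Xr. Qed.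

Lemma bm_X_itself i : (1 <= i <= n)%N -> @bm R _ (itself X i) (X i : T -> R).
Proof.
move=> i1n; split; last by exists r => w; exact: Xr.
by move=> _ B mB; exists B.
Qed.

Lemma bm_X_others i j : (1 <= j <= n)%N -> j != i ->
  @bm R _ (others n X i) (X j : T -> R).
Proof.
move=> j1n ji; split; last by exists r => w; exact: Xr.
move=> _ B mB; rewrite setTI; apply: sub_sigma_algebra.
exists (fun k => if k == j then B else setT).
  by move=> k; case: eqP.
apply/seteqP; split => w /=.
  by move=> Bw k _ /=; case: eqP => // ->.
move=> /(_ j) /=; rewrite in_others_idx j1n ji => /(_ isT).
by rewrite eqxx.
Qed.

Lemma s2_le i : (1 <= i <= n)%N -> s2 i <= r ^+ 2.
Proof.
move=> i1n; rewrite -(Ex_cst P (r ^+ 2)); apply: Ex_le.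
- by apply: bmX; exact: bm_X.
- exact: bm_cst.
- by move=> w; rewrite -real_normK ?num_real// lerXn2r ?nnegrE ?Xr.
Qed.

Lemma bm_S_others i k : (k < i <= n)%N -> @bm R _ (others n X i) (S k).
Proof.
move=> /andP[ki ein]; rewrite /partial_sum.
under eq_fun do rewrite big_nat_cond.
apply: bm_sum => j; rewrite andbT ltnS => /andP[j1 jk].
apply: bm_X_others; last by rewrite ltn_eqF// (leq_ltn_trans jk).
by rewrite j1 (leq_trans jk)// ltnW// (leq_trans ki).
Qed.

Definition Sbut m i w := \sum_(1 <= j < m.+1 | j != i) X j w.

Lemma Sbut_rec m i w : (1 <= i <= m)%N -> S m w = Sbut m i w + X i w.
Proof.
move=> /andP[i1 im]; rewrite /partial_sum /Sbut addrC (bigD1_seq i)//=.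
  by rewrite mem_index_iota i1 ltnS.
exact: iota_uniq.
Qed.

Lemma bm_Sbut m i : (m <= n)%N -> @bm R _ (others n X i) (Sbut m i).
Proof.
move=> mn; rewrite /Sbut.
under eq_fun do rewrite big_nat_cond.
apply: bm_sum => j; rewrite ltnS => /andP[/andP[j1 jm] ji].
by apply: bm_X_others => //; rewrite j1 (leq_trans jm).
Qed.

Lemma bm_S k : (k <= n)%N -> bm (S k).
Proof.
move=> kn; rewrite /partial_sum.
under eq_fun do rewrite big_nat_cond.
apply: bm_sum => j; rewrite andbT ltnS => /andP[j1 jk].
by apply: bm_X; rewrite j1 (leq_trans jk).
Qed.

Let bm_step d' (T' : measurableType d') (c : R) (Y : T' -> R) :
  bm Y -> bm (fun w => ((c < Y w)%R%:R : R)).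
Proof.
apply: (@bm_nondecreasing _ _ _ (fun x => (c < x)%R%:R)) => x y xy.
by case: ltP => cx; [rewrite (lt_le_trans cx xy)|rewrite ler0n].
Qed.

Lemma bm_J_others i k : (k < i <= n)%N -> @bm R _ (others n X i) (J k).
Proof.
elim: k => [|k IH] /andP[ki ein]; first exact: bm_cst.
apply: (@bmM _ _ (others n X i)); first by apply: IH; rewrite (ltnW ki).
by apply: bm_step; apply: bm_S_others; rewrite ki.
Qed.

Lemma bm_J k : (k <= n)%N -> bm (J k).
Proof.
elim: k => [|k IH] kn; first exact: bm_cst.
apply: bmM; first exact: IH (ltnW kn).
by apply: bm_step; exact: bm_S.
Qed.

Lemma Ex_mulX i Y : (1 <= i <= n)%N -> @bm R _ (others n X i) Y ->
  E (fun w => Y w * X i w) = 0.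
Proof.
by move=> i1n bY; rewrite (Ex_indep indX i1n)//; [rewrite EX0// mulr0|exact: bm_X_itself].
Qed.

Lemma Ex_mulX2 i Y : (1 <= i <= n)%N -> @bm R _ (others n X i) Y ->
  E (fun w => Y w * X i w ^+ 2) = s2 i * E Y.
Proof.
move=> i1n bY; rewrite (Ex_indep indX i1n)//; first by rewrite mulrC.
by apply: bmX; exact: bm_X_itself.
Qed.

Lemma alive_cases k w : (k <= n)%N ->
  J k w = 0 \/ (J k w = 1 /\ - gs <= S k w).
Proof.
elim: k => [|k IH] kn; first by right; rewrite S0 oppr_le0.
rewrite /=; case: (IH (ltnW kn)) => [->|[-> _]]; first by left; rewrite mul0r.
rewrite mul1r; case: ltP => gS; [right; split=> //|by left].
have := @ggs k.+1; rewrite kn => /(_ isT).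
by rewrite ler_norml => /andP[h _]; rewrite (le_trans h)// ltW.
Qed.

(** Most one-step estimates see the boundary only through these bounds on the position; the range of
    a dying walk is the origin of [eps = r + gs]. *)
Variant step_spec k w : R -> R -> Prop :=
| StepDead : step_spec k w 0 0
| StepAlive of - gs <= S k w & - gs <= S k.+1 w : step_spec k w 1 1
| StepDies of - gs <= S k w & - gs - r <= S k.+1 w & S k.+1 w <= gs :
    step_spec k w 1 0.

Lemma stepP k w : (k < n)%N -> step_spec k w (J k w) (J k.+1 w).
Proof.
move=> kn.
have gk : `|g k.+1| <= gs by apply: ggs; rewrite kn.
have Xk : `|X k.+1 w| <= r by apply: Xr; rewrite kn.
move: gk Xk; rewrite !ler_norml => /andP[g1 g2] /andP[x1 x2].
rewrite [J k.+1 w]/=; case: (alive_cases w (ltnW kn)) => [->|[-> Sk]].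
  by rewrite mul0r; exact: StepDead.
rewrite mul1r; case: ltP => gS; [apply: StepAlive|apply: StepDies] => //.
- by lra.
- by rewrite S_rec; lra.
- by lra.
Qed.

Lemma alive_ge0 k w : 0 <= J k w.
Proof. by elim: k => //= k IH; rewrite mulr_ge0. Qed.

Lemma alive_le k w : J k.+1 w <= J k w.
Proof. by rewrite /= ler_piMr ?alive_ge0// lern1 leq_b1. Qed.

Lemma alive_le_trans j k w : (j <= k)%N -> J k w <= J j w.
Proof.
elim: k => [|k IH]; first by rewrite leqn0 => /eqP ->.
rewrite leq_eqVlt => /predU1P[-> //|]; rewrite ltnS => /IH.
by apply: le_trans; exact: alive_le.
Qed.

Definition alive_prob k := E (J k).
Local Notation p := alive_prob.

Lemma p_le j k : (j <= k)%N -> (k <= n)%N -> p k <= p j.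
Proof.
move=> jk kn; apply: Ex_le; [exact: bm_J| |by move=> w; exact: alive_le_trans].
by apply: bm_J; exact: leq_trans kn.
Qed.

Lemma Ex_freeze_step k (F : R -> R) (H : T -> R) :
  (k < n)%N -> {homo F : x y / x <= y} -> @bm R _ (others n X k.+1) H ->
  E (fun w => H w * F (S k.+1 w)) =
  E (fun w => H w * E (fun w' => F (S k w + X k.+1 w'))).
Proof.
move=> kn ndF bH; have i1n : (1 <= k.+1 <= n)%N by rewrite kn.
pose G (z : itself X k.+1 * others n X k.+1) :=
  H z.2 * F (S k z.2 + X k.+1 z.1).
have bZ : bm (fun z : itself X k.+1 * others n X k.+1 => S k z.2 + X k.+1 z.1).
  apply: bmD; first by apply: bm_snd; apply: bm_S_others; rewrite ltnSn.
  by apply: bm_fst; exact: bm_X_itself.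
have bG : bm G by apply: bmM; [exact: bm_snd|exact: bm_nondecreasing].
transitivity (E (fun w => G (w, w))).
  by congr Ex; apply/funext => w; rewrite /G S_rec.
rewrite (Ex_freeze indX i1n bG); congr Ex; apply/funext => w.
rewrite -ExZ//; apply: bm_nondecreasing => //.
by apply: bmD; [exact: bm_cst|exact: bm_X].
Qed.

(** * Harris' inequality *)

Hypothesis Jn_gt0 : 0 < p n.

Lemma p_gt0 k : (k <= n)%N -> 0 < p k.
Proof. by move=> kn; rewrite (lt_le_trans Jn_gt0)// p_le. Qed.

Lemma p_ge0 k : 0 <= p k.
Proof. by apply: Ex_ge0 => w; exact: alive_ge0. Qed.

(* Survival and the endpoint are both nondecreasing functions of the
   independent increments, hence positively correlated. *)
Lemma harris k (f : R -> R) : (k <= n)%N -> {homo f : x y / x <= y} ->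
  (forall x, 0 <= f x) ->
  p k * E (fun w => f (S k w)) <= E (fun w => J k w * f (S k w)).
Proof.
elim: k f => [|k IH] f kn ndf f0.
  rewrite /p [E (J 0)]Ex_cst mul1r le_eqVlt; apply/orP; left; apply/eqP.
  by congr Ex; apply/funext => w; rewrite mul1r.
have kn' := ltnW kn.
pose u x : R := (g k.+1 < x)%R%:R.
have ndu : {homo u : x y / x <= y}.
  move=> x y xy; rewrite /u.
  by case: ltP => cx; [rewrite (lt_le_trans cx xy)|rewrite ler0n].
have u0 x : 0 <= u x by exact: ler0n.
have bshift x : bm (fun w => x + X k.+1 w).
  by apply: bmD; [exact: bm_cst|apply: bm_X; rewrite kn].
have nd_shift h : {homo h : x y / x <= y} ->
    {homo (fun x => E (fun w => h (x + X k.+1 w))) : x y / x <= y}.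
  move=> ndh x y xy; apply: Ex_le; try by apply: bm_nondecreasing.
  by move=> w; apply: ndh; rewrite lerD2r.
pose q x := E (fun w => u (x + X k.+1 w)).
pose F x := E (fun w => f (x + X k.+1 w)).
have nduf : {homo (fun x => u x * f x) : x y / x <= y}.
  by move=> x y xy; rewrite ler_pM// ?ndu ?ndf.
have bJo : @bm R _ (others n X k.+1) (J k) by apply: bm_J_others; rewrite ltnSn.
have bJ : bm (J k) by exact: bm_J.
have bS : bm (S k) by exact: bm_S.
have e1 : E (fun w => J k.+1 w * f (S k.+1 w)) =
    E (fun w => J k w * E (fun w' => u (S k w + X k.+1 w') * f (S k w + X k.+1 w'))).
  rewrite -(@Ex_freeze_step k (fun x => u x * f x) (J k))//.
  by congr Ex; apply/funext => w /=; rewrite mulrA.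
have e2 : p k.+1 = E (fun w => J k w * q (S k w)).
  by rewrite /p /q -(@Ex_freeze_step k u (J k)).
have e3 : E (fun w => f (S k.+1 w)) = E (fun w => F (S k w)).
  transitivity (E (fun w => (fun=> 1) w * f (S k.+1 w))).
    by congr Ex; apply/funext => w; rewrite mul1r.
  rewrite (@Ex_freeze_step k f (fun=> 1))//; last exact: bm_cst.
  by congr Ex; apply/funext => w; rewrite mul1r.
have ndF : {homo F : x y / x <= y} by exact: nd_shift.
have ndq : {homo q : x y / x <= y} by exact: nd_shift.
have bF : bm (fun w => F (S k w)) by exact: bm_nondecreasing.
have bq : bm (fun w => q (S k w)) by exact: bm_nondecreasing.
(* The last increment is treated by [association] with the position at time [k] frozen, and that
   position by Chebyshev's inequality weighted by [J k]. The induction hypothesis is then applied to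
   [F]. *)
have c1 : E (fun w => J k w * (q (S k w) * F (S k w))) <=
    E (fun w => J k.+1 w * f (S k.+1 w)).
  rewrite e1; apply: Ex_le.
  - by bm_auto.
  - apply: bmM => //.
    exact: (bm_nondecreasing (nd_shift _ nduf) bS).
  - move=> w; rewrite ler_wpM2l ?alive_ge0//.
    exact: (@association _ _ _ P _ u f (bshift _) ndu ndf).
have c2 := @chebyshev_association _ _ _ P (J k) (S k) q F bJ bS
  (alive_ge0 k) ndq ndF.
have c3 := IH F kn' ndF (fun x => Ex_ge0 _ (fun w => f0 _)).
(* Chebyshev's inequality carries the total weight [p k] on its right-hand side; it can be cancelled
   because survival has positive probability. *)
rewrite -(ler_pM2l (p_gt0 kn')) e3.
apply: le_trans (ler_wpM2l (p_ge0 k) c1).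
apply: le_trans c2; rewrite -e2 mulrCA.
by apply: ler_wpM2l => //; exact: p_ge0.
Qed.

(** * The excess over the boundary and [E_n] *)

Definition overshoot := E (fun w => (S n w - g n) * J n w).

Local Notation En := overshoot.

(** The positive part is convex, and [H] is a subgradient of it, so the term [H * X k.+1] of mean
    zero supports the increment. Killing loses nothing: a walk dies only at a position at most [gs],
    where the excess vanishes. *)
Lemma Ex_excess_mono k : (k < n)%N ->
  E (fun w => J k w * Num.max (S k w - gs) 0) <=
  E (fun w => J k.+1 w * Num.max (S k.+1 w - gs) 0).
Proof.
move=> kn; have kn' := ltnW kn.
have bJo : @bm R _ (others n X k.+1) (J k) by apply: bm_J_others; rewrite ltnSn.
have bSo : @bm R _ (others n X k.+1) (S k) by apply: bm_S_others; rewrite ltnSn.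
have bJ := bm_J kn'; have bJ' := bm_J kn; have bS := bm_S kn'; have bS' := bm_S kn.
have bX : bm (X k.+1 : T -> R) by apply: bm_X; rewrite kn.
pose H w := J k w * ((gs < S k w)%R%:R : R).
have bHo : @bm R _ (others n X k.+1) H.
  by apply: (@bmM _ _ (others n X k.+1)) => //; exact: bm_step.
have bH : bm H by exact: bm_others bHo.
have EHX : E (fun w => H w * X k.+1 w) = 0 by apply: Ex_mulX => //; rewrite kn.
rewrite -[leLHS]addr0 -[X in _ + X <= _]EHX.
rewrite -ExD; [|by bm_auto|by bm_auto].
apply: Ex_le; [by bm_auto|by bm_auto|] => w; rewrite /H.
have [|Sk Sk1|Sk Sk1 Sk1'] := stepP w kn; rewrite ?mul0r ?addr0// !mul1r.
  rewrite S_rec; case: (ltP gs (S k w)) => gS; case: (leP (S k w - gs) 0) => h1;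
    case: (leP (S k w + X k.+1 w - gs) 0) => h2; rewrite /=; lra.
rewrite S_rec in Sk1 Sk1'.
case: (ltP gs (S k w)) => gS; case: (leP (S k w - gs) 0) => h1; rewrite /=; lra.
Qed.

Lemma Ex_excess_le_trans j k : (j <= k)%N -> (k <= n)%N ->
  E (fun w => J j w * Num.max (S j w - gs) 0) <=
  E (fun w => J k w * Num.max (S k w - gs) 0).
Proof.
elim: k => [|k IH]; first by rewrite leqn0 => /eqP ->.
rewrite leq_eqVlt => /predU1P[-> //|]; rewrite ltnS => jk kn.
by rewrite (le_trans (IH jk (ltnW kn)))// Ex_excess_mono.
Qed.

Hypothesis n1 : (1 <= n)%N.

Lemma Ex_excess_le k : (k <= n)%N ->
  E (fun w => J k w * Num.max (S k w - gs) 0) <= En.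
Proof.
move=> kn; apply: le_trans (Ex_excess_le_trans kn (leqnn n)) _.
have bJ := bm_J (leqnn n); have bS := bm_S (leqnn n).
apply: Ex_le; [by bm_auto|by bm_auto|] => w.
rewrite mulrC; case: (posnP n) n1 => [->//|n0 _].
have gn : `|g n| <= gs by apply: ggs; rewrite n1 leqnn.
move: gn; rewrite ler_norml => /andP[_ gn].
rewrite -(prednK n0) /= (prednK n0).
case: ltP => h; last by rewrite !mulr0.
rewrite ler_wpM2r ?mulr_ge0 ?alive_ge0//.
by case: (leP (S n w - gs) 0) => h1; lra.
Qed.

Lemma overshoot_ge0 : 0 <= En.
Proof.
apply: le_trans (Ex_excess_le (leqnn n)); apply: Ex_ge0 => w.
by rewrite mulr_ge0 ?alive_ge0// le_max lexx orbT.
Qed.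

Lemma p_excess_le k : (k <= n)%N ->
  p k * E (fun w => Num.max (S k w - gs) 0) <= En.
Proof.
move=> kn; apply: le_trans (Ex_excess_le kn).
apply: (@harris k (fun x => Num.max (x - gs) 0)) => //.
  by move=> x y xy; case: (leP (x - gs) 0) => h1; case: (leP (y - gs) 0) => h2; lra.
by move=> x; rewrite le_max lexx orbT.
Qed.

(** * Moments of the free walk and the bound on [P(T > m)] *)

Lemma Ex_S2 m : (m <= n)%N -> E (fun w => S m w ^+ 2) = t m.
Proof.
elim: m => [|m IH] mn.
  rewrite /t big_geq// -[RHS](Ex_cst P); congr Ex; apply/funext => w.
  by rewrite S0 expr0n.
have mn' := ltnW mn.
have bSo : @bm R _ (others n X m.+1) (S m) by apply: bm_S_others; rewrite ltnSn.
have bS := bm_S mn'.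
have bX : bm (X m.+1 : T -> R) by apply: bm_X; rewrite mn.
have -> : (fun w => S m.+1 w ^+ 2) =
    (fun w => S m w ^+ 2 + 2 * (S m w * X m.+1 w) + X m.+1 w ^+ 2).
  by apply/funext => w; rewrite S_rec; ring.
rewrite !ExD ?ExZ; try by bm_auto.
by rewrite IH// Ex_mulX// ?mn// mulr0 addr0 t_rec.
Qed.

Let abs_square_incr (s x : R) :
  x * ((s + x) * `|s + x| - s * `|s|) <= 2 * (`|s| * x ^+ 2) + `|x| * x ^+ 2.
Proof.
have h : `|(s + x) * `|s + x| - s * `|s| | <= `|x| * (2 * `|s| + `|x|).
  rewrite ler_norml; apply/andP; split;
    case: (ger0P s) => hs; case: (ger0P (s + x)) => hsx; case: (ger0P x) => hx; nra.
apply: le_trans (ler_norm _) _; rewrite normrM.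
apply: (le_trans (ler_wpM2l (normr_ge0 x) h)).
by rewrite -[x ^+ 2]real_normK ?num_real//; lra.
Qed.

(* Since [|S|^3 = S * (S * |S|)], each increment may be paired with the change
   it causes in [S * |S|], whose derivative is [2 * |S|]. *)
Lemma Ex_absS3_le m : (m <= n)%N ->
  E (fun w => `|S m w| ^+ 3) <= 2 * t m * E (fun w => `|S m w|) + 3 * r * t m.
Proof.
move=> mn; have bS := bm_S mn.
have bX i : (1 <= i <= m)%N -> bm (X i : T -> R).
  by move=> /andP[i1 im]; apply: bm_X; rewrite i1 (leq_trans im).
have -> : (fun w => `|S m w| ^+ 3) =
    (fun w => \sum_(1 <= i < m.+1) X i w * (S m w * `|S m w|)).
  apply/funext => w; rewrite -mulr_suml -/(partial_sum _ m w) exprSr mulrA.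
  by rewrite -expr2 real_normK ?num_real// expr2 -mulrA.
under eq_fun do rewrite big_nat_cond.
rewrite Ex_sum; last first.
  by move=> i /andP[im _]; have bXi := bX i im; bm_auto.
apply: (@le_trans _ _ (\sum_(1 <= i < m.+1)
    (s2 i * (2 * (E (fun w => `|S m w|) + r) + r)))).
  rewrite -[leLHS]big_nat_cond; apply: ler_sum_nat => i im.
  have in_n : (1 <= i <= n)%N.
    by move: im => /andP[-> im]; rewrite (leq_trans _ mn).
  pose U := Sbut m i.
  have bUo : @bm R _ (others n X i) U by exact: bm_Sbut.
  have bU : bm U by exact: bm_others bUo.
  have bXi : bm (X i : T -> R) by exact: bm_X.
  have E0 : E (fun w => (U w * `|U w|) * X i w) = 0.
    by apply: Ex_mulX => //; apply: (@bmM _ _ (others n X i)) => //; exact: bm_norm.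
  have E2 : E (fun w => `|U w| * X i w ^+ 2) = s2 i * E (fun w => `|U w|).
    by apply: Ex_mulX2 => //; exact: bm_norm.
  have EU : E (fun w => `|U w|) <= E (fun w => `|S m w|) + r.
    rewrite -[X in _ + X](Ex_cst P r) -ExD; try by bm_auto.
    apply: Ex_le; try by bm_auto.
    move=> w; rewrite (Sbut_rec w im) -/U.
    have := ler_normB (U w + X i w) (X i w); rewrite addrK => h.
    by rewrite (le_trans h)// lerD2l Xr.
  apply: (@le_trans _ _ (E (fun w => (U w * `|U w|) * X i w +
      (2 * (`|U w| * X i w ^+ 2) + r * X i w ^+ 2)))).
    apply: Ex_le; try by bm_auto.
    move=> w; rewrite (Sbut_rec w im) -/U.
    have h := abs_square_incr (U w) (X i w).
    have h2 : `|X i w| * X i w ^+ 2 <= r * X i w ^+ 2.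
      by rewrite ler_wpM2r ?sqr_ge0 ?Xr.
    by move: h h2; rewrite mulrBr => h h2; lra.
  rewrite !ExD ?E0 ?add0r ?ExZ ?E2; try by bm_auto.
  have -> : E (fun w => X i w ^+ 2) = s2 i by [].
  set e := E (fun w => `|U w|).
  rewrite [leLHS](_ : _ = s2 i * (2 * e + r)); last by ring.
  by rewrite ler_wpM2l ?s2_ge0// lerD2r ler_wpM2l.
rewrite -mulr_suml -/(t m) le_eqVlt; apply/orP; left; apply/eqP; ring.
Qed.

(** Taking the mean of [x * (2 * B - x) ^ 2 >= 0] at [x = |S m|] bounds the first absolute moment
    below by the second and third ones, and the third is itself controlled by the first through
    [Ex_absS3_le]. *)
Lemma Ex_absS_ge m (B : R) : (m <= n)%N -> 0 < B -> B ^+ 2 = t m ->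
  4 * B - 3 * r <= 6 * E (fun w => `|S m w|).
Proof.
move=> mn B0 BE; have bS := bm_S mn.
have h : 4 * B * t m - E (fun w => `|S m w| ^+ 3) <=
    4 * B ^+ 2 * E (fun w => `|S m w|).
  rewrite -Ex_S2// -!ExZ -?ExB; try by bm_auto.
  apply: Ex_le; try by bm_auto.
  move=> w; rewrite -[S m w ^+ 2]real_normK ?num_real// -subr_ge0.
  set x := `|S m w|; rewrite (_ : _ - _ = x * (2 * B - x) ^+ 2); last by ring.
  by rewrite mulr_ge0 ?normr_ge0 ?sqr_ge0.
have h3 := Ex_absS3_le mn; rewrite -BE in h h3.
set e := E (fun w => `|S m w|) in h h3 *.
rewrite -(ler_pM2l (_ : 0 < B ^+ 2)) ?exprn_gt0//; nra.
Qed.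

(** Since [S m] is centred, its mean excess over [gs] is at least [E|S m| / 2 - gs], hence at least
    [B / 3 - r / 4 - gs]. The assumption on [B] makes this at least [B / 4], and Harris' inequality
    in the form [p_excess_le] concludes. *)
Lemma p_le_overshoot m (B : R) : (m <= n)%N -> 0 < B -> B ^+ 2 = t m ->
  24 * (r + gs) <= B -> p m * B <= 4 * En.
Proof.
move=> mn B0 BE hB; have hr := r0; have hgs := gs0; have bS := bm_S mn.
have h1 := Ex_absS_ge mn B0 BE.
have ES0 : E (S m) = 0.
  rewrite /partial_sum; under eq_fun do rewrite big_nat_cond.
  have m1n i : (1 <= i < m.+1)%N && true -> (1 <= i <= n)%N.
    by rewrite andbT ltnS => /andP[i1 im]; rewrite i1 (leq_trans im).
  rewrite Ex_sum; last by move=> i /m1n; exact: bm_X.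
  by rewrite big1// => i /m1n; exact: EX0.
have h2 : E (fun w => `|S m w|) <= 2 * E (fun w => Num.max (S m w - gs) 0) + 2 * gs.
  rewrite -[X in _ <= _ + X](Ex_cst P) -ExZ; last by bm_auto.
  rewrite -ExD; try by bm_auto.
  rewrite -[leLHS]addr0 -[X in _ + X <= _]ES0 -ExD//; last by bm_auto.
  apply: Ex_le; try by bm_auto.
  by move=> w; case: (ger0P (S m w)) => ?; case: (leP (S m w - gs) 0) => ?; lra.
have h3 := p_excess_le mn; have p0 := p_gt0 mn.
set e := E (fun w => Num.max _ _) in h2 h3.
have : p m * (B / 4) <= p m * e by rewrite ler_pM2l//; lra.
by lra.
Qed.

(** * Anticoncentration *)

Lemma p_alive_increment j l : (j <= l)%N -> (l <= n)%N ->
  E (fun w => J j w * (S l w - S j w) ^+ 2) = p j * (t l - t j).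
Proof.
move=> jl ln; elim: l => [|l IH] in jl ln *.
  move: jl; rewrite leqn0 => /eqP ->; rewrite subrr mulr0 -[RHS](Ex_cst P).
  by congr Ex; apply/funext => w; rewrite subrr expr0n mulr0.
move: jl; rewrite leq_eqVlt => /predU1P[->|]; last rewrite ltnS => jl.
  rewrite subrr mulr0 -[RHS](Ex_cst P).
  by congr Ex; apply/funext => w; rewrite subrr expr0n mulr0.
have ln' := ltnW ln.
have bJo : @bm R _ (others n X l.+1) (J j) by apply: bm_J_others; rewrite ltnS jl.
have bSo : @bm R _ (others n X l.+1) (S l) by apply: bm_S_others; rewrite ltnSn.
have bSjo : @bm R _ (others n X l.+1) (S j) by apply: bm_S_others; rewrite ltnS jl.
have bJ := bm_others bJo; have bS := bm_others bSo; have bSj := bm_others bSjo.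
have bX : bm (X l.+1 : T -> R) by apply: bm_X; rewrite ln.
have -> : (fun w => J j w * (S l.+1 w - S j w) ^+ 2) =
    (fun w => J j w * (S l w - S j w) ^+ 2 +
      2 * ((J j w * (S l w - S j w)) * X l.+1 w) + J j w * X l.+1 w ^+ 2).
  by apply/funext => w; rewrite S_rec; ring.
rewrite !ExD ?ExZ; try by bm_auto.
rewrite IH// Ex_mulX2 ?ln// Ex_mulX ?ln//; last first.
  by apply: (@bmM _ _ (others n X l.+1)) => //; exact: bmB.
by rewrite t_rec /p; ring.
Qed.

Let bm_atan d' (T' : measurableType d') (a y : R) (Y : T' -> R) : bm Y ->
  bm (fun w => atan ((Y w + y) / a)).
Proof.
move=> bY; apply: (@bm_comp _ _ _ atan _ 2).
- by apply: continuous_measurable_fun => x; exact: continuous_atan.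
- move=> x; have p4 := @pihalf_lt2 R; have := atan_gtNpi2 x; have := atan_ltpi2 x.
  by rewrite ler_norml => h1 h2; apply/andP; split; lra.
- apply: bmM; last exact: bm_cst.
  by apply: bmD => //; exact: bm_cst.
Qed.

Let bm_lorentz d' (T' : measurableType d') (a y : R) (Y : T' -> R) : bm Y ->
  bm (fun w => lorentz ((Y w + y) / a)).
Proof.
move=> bY; apply: (@bm_comp _ _ _ (@lorentz R) _ 1).
- apply: continuous_measurable_fun => x; apply: cvgV.
    by rewrite gt_eqF// ltr_pwDl// sqr_ge0.
  by apply: cvgD; [exact: cvg_cst|exact: exprn_continuous].
- by move=> x; rewrite ger0_norm ?lorentz_le1// ltW// lorentz_gt0.
- apply: bmM; last exact: bm_cst.
  by apply: bmD => //; exact: bm_cst.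
Qed.

Let lorentz_near (a s x : R) : 0 < a -> `|x| <= a ->
  lorentz (s / a) <= 3 * lorentz ((s + x) / a).
Proof.
move=> a0 xa; apply: lorentz_shift.
rewrite (_ : _ - _ = - (x / a)); last by field; rewrite gt_eqF.
by rewrite normrN normrM normfV (gtr0_norm a0) ler_pdivrMr// mul1r.
Qed.

(** The mean value theorem puts the derivative at a point within [a] of [s], where [lorentz_near]
    loses a factor 3. An increment of [atan] has the sign of [x], so the product is nonnegative in
    both cases. *)
Let atan_incr (a s x : R) : 0 < a -> `|x| <= a ->
  x ^+ 2 * lorentz (s / a) <= 3 * a * (x * (atan ((s + x) / a) - atan (s / a))).
Proof.
move=> a0 xa.
have dat (u : R) : is_derive u 1 (@atan R) (lorentz u) by exact: is_derive1_atan.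
have cat u v : {within `[u, v], continuous (@atan R)}.
  apply: derivable_within_continuous => z _; exact: (@ex_derive _ _ _ _ _ _ _ (dat z)).
have [c + eq] : exists2 c, c \in `[- `|x|, `|x|] &
    atan ((s + x) / a) - atan (s / a) = lorentz ((s + c) / a) * (x / a).
  have e : (s + x) / a - s / a = x / a by field; rewrite gt_eqF.
  have ec (c : R) : (s + (c * a - s)) / a = c by field; rewrite gt_eqF.
  have [x0|x0] := leP 0 x.
    have le : s / a <= (s + x) / a by rewrite ler_pM2r ?invr_gt0// lerDl.
    have [c + ->] := MVT_segment le (fun u _ => dat u) (cat _ _).
    rewrite in_itv/= ler_pdivrMr// ler_pdivlMr// => /andP[h1 h2].
    exists (c * a - s); last by rewrite e ec.
    by rewrite in_itv/= ger0_norm//; apply/andP; split; lra.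
  have le : (s + x) / a <= s / a by rewrite ler_pM2r ?invr_gt0//; lra.
  have [c + h] := MVT_segment le (fun u _ => dat u) (cat _ _).
  rewrite in_itv/= ler_pdivrMr// ler_pdivlMr// => /andP[h1 h2].
  exists (c * a - s); last first.
    by rewrite ec -opprB h -mulrN opprB e.
  by rewrite in_itv/= ltr0_norm//; apply/andP; split; lra.
rewrite in_itv/= => /andP[c1 c2].
have hc : lorentz (s / a) <= 3 * lorentz ((s + c) / a).
  apply: lorentz_near => //; apply: le_trans xa.
  by rewrite ler_norml c1 c2.
rewrite eq (_ : 3 * a * _ = x ^+ 2 * (3 * lorentz ((s + c) / a))); last first.
  by field; rewrite gt_eqF.
by rewrite ler_wpM2l ?sqr_ge0.
Qed.

(* Stein's method with the bounded test function [atan], whose derivative is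
   [lorentz]: pairing an increment with [atan] of the walk recovers [lorentz]. *)
Lemma anticoncentration j l (a y : R) : (j <= l)%N -> (l <= n)%N ->
  t l - t j <= 1 -> 0 < a -> r <= a ->
  (t l - t j) * E (fun w => J j w * lorentz ((S l w + y) / a)) <= 18 * a * p j.
Proof.
move=> jl ln tlj a0 ra.
have jn := leq_trans jl ln.
have bJ := bm_J jn; have bSj := bm_S jn; have bS := bm_S ln.
have bA : bm (fun w => atan ((S l w + y) / a)) by exact: bm_atan.
have bL : bm (fun w => lorentz ((S l w + y) / a)) by exact: bm_lorentz.
(* As [|atan| < 2], the product of [atan] with the increment [D] is at most [1 + D ^ 2], and [D ^ 2]
   has weighted mean at most [p j]. *)
have up : E (fun w => J j w * (S l w - S j w) * atan ((S l w + y) / a)) <= 2 * p j.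
  apply: (@le_trans _ _ (E (fun w => J j w + J j w * (S l w - S j w) ^+ 2))).
    apply: Ex_le; try by bm_auto.
    move=> w; rewrite -mulrA.
    rewrite [leRHS](_ : _ = J j w * (1 + (S l w - S j w) ^+ 2)); last by ring.
    apply: ler_wpM2l; first exact: alive_ge0.
    set D := S l w - S j w; set A := atan _.
    have A1 : A < 2.
      by have p4 := @pihalf_lt2 R; have := atan_ltpi2 ((S l w + y) / a); rewrite -/A; lra.
    have A2 : - 2 < A.
      by have p4 := @pihalf_lt2 R; have := atan_gtNpi2 ((S l w + y) / a); rewrite -/A; lra.
    have := sqr_ge0 (2 * D - A); nra.
  rewrite ExD; try by bm_auto.
  rewrite p_alive_increment// -/(p j).
  have := ler_wpM2l (p_ge0 j) tlj; lra.
have sumE : (fun w => J j w * (S l w - S j w) * atan ((S l w + y) / a)) =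
    (fun w => \sum_(j.+1 <= i < l.+1) J j w * X i w * atan ((S l w + y) / a)).
  apply/funext => w; rewrite -!mulr_suml -mulr_sumr; congr (_ * _ * _).
  have e : S l w = S j w + \sum_(j.+1 <= i < l.+1) X i w.
    by rewrite /partial_sum -big_cat_nat.
  by rewrite e addrAC subrr add0r.
have in_n i : (j < i < l.+1)%N -> (1 <= i <= n)%N.
  by move=> /andP[ji il]; rewrite (leq_ltn_trans _ ji)// (leq_trans _ ln).
(* Leaving [X i] out of the walk makes [U] independent of it; the [atan] of [U] can be subtracted
   because its product with [X i] has mean zero. One factor 3 comes from [atan_incr], the other from
   returning to [S l] inside [lorentz]. *)
have low i : (j < i < l.+1)%N ->
    s2 i * E (fun w => J j w * lorentz ((S l w + y) / a)) <=
    9 * a * E (fun w => J j w * X i w * atan ((S l w + y) / a)).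
  move=> ji; have i1n := in_n i ji; have /andP[ji1 ji2] := ji.
  have il : (1 <= i <= l)%N.
    by apply/andP; split; [exact: leq_ltn_trans ji1|rewrite -ltnS].
  pose U := Sbut l i.
  have bUo : @bm R _ (others n X i) U by exact: bm_Sbut.
  have bJo : @bm R _ (others n X i) (J j).
    by apply: bm_J_others; rewrite ji1; case/andP: i1n.
  have bU : bm U by exact: bm_others bUo.
  have bX : bm (X i : T -> R) by exact: bm_X.
  have bLU : bm (fun w => lorentz ((U w + y) / a)) by exact: bm_lorentz.
  have bAU : bm (fun w => atan ((U w + y) / a)) by exact: bm_atan.
  have e0 : E (fun w => J j w * atan ((U w + y) / a) * X i w) = 0.
    apply: Ex_mulX => //; apply: (@bmM _ _ (others n X i)) => //.
    exact: (@bm_atan _ (others n X i)).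
  have e2 : E (fun w => J j w * lorentz ((U w + y) / a) * X i w ^+ 2) =
      s2 i * E (fun w => J j w * lorentz ((U w + y) / a)).
    apply: Ex_mulX2 => //; apply: (@bmM _ _ (others n X i)) => //.
    exact: (@bm_lorentz _ (others n X i)).
  have h1 : E (fun w => J j w * lorentz ((S l w + y) / a)) <=
      3 * E (fun w => J j w * lorentz ((U w + y) / a)).
    rewrite -ExZ; try by bm_auto.
    apply: Ex_le; try by bm_auto.
    move=> w; rewrite mulrCA; apply: ler_wpM2l; first exact: alive_ge0.
    rewrite (Sbut_rec w il) -/U.
    have := @lorentz_near a (U w + X i w + y) (- X i w) a0.
    rewrite normrN (_ : U w + X i w + y - X i w = U w + y); last by ring.
    by apply; rewrite (le_trans _ ra)// Xr.
  apply: (le_trans (ler_wpM2l (s2_ge0 i) h1)).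
  rewrite mulrCA -e2 -[X in 9 * a * X]subr0 -[X in _ * (_ - X)]e0.
  rewrite -ExB; try by bm_auto.
  rewrite -!ExZ; try by bm_auto.
  apply: Ex_le; try by bm_auto.
  move=> w; rewrite (Sbut_rec w il) -/U.
  have := @atan_incr a (U w + y) (X i w) a0 (le_trans (Xr w i1n) ra).
  rewrite (_ : U w + y + X i w = U w + X i w + y); last by ring.
  move=> /(ler_wpM2l (alive_ge0 j w)); lra.
have : \sum_(j.+1 <= i < l.+1) s2 i * E (fun w => J j w * lorentz ((S l w + y) / a)) <=
    \sum_(j.+1 <= i < l.+1) 9 * a * E (fun w => J j w * X i w * atan ((S l w + y) / a)).
  by apply: ler_sum_nat => i; exact: low.
rewrite -mulr_suml -mulr_sumr.
have -> : \sum_(j.+1 <= i < l.+1) s2 i = t l - t j.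
  have e : t l = t j + \sum_(j.+1 <= i < l.+1) s2 i by rewrite /t -big_cat_nat.
  by rewrite e addrAC subrr add0r.
move=> h; apply: (le_trans h).
rewrite (_ : 18 * a * p j = 9 * a * (2 * p j)); last by ring.
apply: ler_wpM2l; first by rewrite mulr_ge0// ltW.
apply: le_trans up; rewrite sumE big_nat_cond.
under [X in _ <= Ex _ X]eq_fun do rewrite big_nat_cond.
rewrite Ex_sum// => i /andP[/in_n i1n _].
by have bX := bm_X i1n; bm_auto.
Qed.

(** * Cubic moment and mean of the surviving walk *)

Local Notation eps := (r + gs).

(** The linear term has mean zero in a step, so the truncated cube grows only by the quadratic one.
    The gap between the thresholds [gs] and [2 * eps] absorbs the cubic remainder, which is at most
    [r * x ^ 2]. *)
Let cube_incr (s x : R) : `|x| <= r ->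
  Num.max (s + x - 2 * eps) 0 ^+ 3 <=
  Num.max (s - 2 * eps) 0 ^+ 3 + 3 * (Num.max (s - 2 * eps) 0 ^+ 2 * x) +
  4 * (Num.max (s - gs) 0 * x ^+ 2).
Proof.
have hr := r0; have hgs := gs0.
rewrite ler_norml => /andP[x1 x2]; have xx := sqr_ge0 x.
have rx : 0 <= (r - x) * x ^+ 2 by rewrite mulr_ge0// subr_ge0.
have [s1|s1] := leP (s - 2 * eps) 0.
  rewrite !expr0n /= mul0r mulr0 !add0r.
  have [s2|s2] := leP (s + x - 2 * eps) 0.
    by rewrite expr0n /= mulr_ge0// mulr_ge0// le_max lexx orbT.
  have -> : Num.max (s - gs) 0 = s - gs by apply/max_idPl; lra.
  have y0 : 0 <= s + x - 2 * eps by exact: ltW.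
  have yx : s + x - 2 * eps <= x by lra.
  have h3 : (s + x - 2 * eps) ^+ 3 <= x ^+ 3 by rewrite lerXn2r ?nnegrE//; lra.
  have h4 : 0 <= (s - gs - r) * x ^+ 2 by rewrite mulr_ge0//; lra.
  have h5 : 0 <= (s - gs) * x ^+ 2 by rewrite mulr_ge0//; lra.
  by move: rx h3 h4 h5; rewrite [x ^+ 3]exprS; lra.
have -> : Num.max (s - gs) 0 = s - gs by apply/max_idPl; lra.
set m := s - 2 * eps.
have m0 : 0 < m by [].
have h6 : 0 <= (4 * (s - gs) - 3 * m - r) * x ^+ 2.
  by rewrite mulr_ge0// /m; lra.
have e : s + x - 2 * eps = m + x by rewrite /m; ring.
rewrite e; have [s2|s2] := leP (m + x) 0; last by lra.
rewrite expr0n /=.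
have h7 : 0 <= r * x ^+ 2 by rewrite mulr_ge0.
have h8 : 0 <= m * (m ^+ 2 + 3 * m * x + 3 * x ^+ 2).
  apply: mulr_ge0; first exact: ltW.
  have := sqr_ge0 (2 * m + 3 * x); lra.
by move: h6 h7 h8; lra.
Qed.

(** Each step adds at most [4 * s2 * En] by [cube_incr] and [Ex_excess_le], and the truncated cube
    vanishes at a dying walk. Proportionality to [t k * En] is what makes the linearisation error
    relative to [En]. *)
Lemma cubic_moment k : (k <= n)%N ->
  E (fun w => J k w * Num.max (S k w - 2 * eps) 0 ^+ 3) <= 4 * t k * En.
Proof.
have hr := r0; have hgs := gs0.
elim: k => [|k IH] kn.
  rewrite /t big_geq// mulr0 mul0r -(Ex_cst P 0).
  rewrite (_ : (fun w => _) = fun=> 0) ?Ex_cst//; apply/funext => w.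
  rewrite S0; have -> : Num.max (0 - 2 * eps) 0 = 0 by apply/max_idPr; lra.
  by rewrite expr0n mulr0.
have kn' := ltnW kn.
have bJo : @bm R _ (others n X k.+1) (J k) by apply: bm_J_others; rewrite ltnSn.
have bSo : @bm R _ (others n X k.+1) (S k) by apply: bm_S_others; rewrite ltnSn.
have bJ := bm_J kn'; have bJ' := bm_J kn; have bS := bm_S kn'; have bS' := bm_S kn.
have bX : bm (X k.+1 : T -> R) by apply: bm_X; rewrite kn.
have b0 d' (T' : measurableType d') (Y : T' -> R) c : bm Y ->
  bm (fun w => Num.max (Y w - c) 0) by move=> bY; bm_auto.
have e1 : E (fun w => (J k w * Num.max (S k w - 2 * eps) 0 ^+ 2) * X k.+1 w) = 0.
  apply: Ex_mulX; first by rewrite kn.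
  by apply: (@bmM _ _ (others n X k.+1)) => //; apply: bmX; exact: (@b0 _ (others n X k.+1)).
have e2 : E (fun w => (J k w * Num.max (S k w - gs) 0) * X k.+1 w ^+ 2) =
    s2 k.+1 * E (fun w => J k w * Num.max (S k w - gs) 0).
  apply: Ex_mulX2; first by rewrite kn.
  by apply: (@bmM _ _ (others n X k.+1)) => //; exact: (@b0 _ (others n X k.+1)).
apply: (@le_trans _ _ (E (fun w => J k w * Num.max (S k w - 2 * eps) 0 ^+ 3 +
    3 * ((J k w * Num.max (S k w - 2 * eps) 0 ^+ 2) * X k.+1 w) +
    4 * ((J k w * Num.max (S k w - gs) 0) * X k.+1 w ^+ 2)))).
  apply: Ex_le; try by bm_auto.
  move=> w; have h := cube_incr (S k w) (Xr w (_ : (1 <= k.+1 <= n)%N)).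
  rewrite -S_rec in h.
  have {}h : J k w * Num.max (S k.+1 w - 2 * eps) 0 ^+ 3 <=
    J k w * (Num.max (S k w - 2 * eps) 0 ^+ 3 +
      3 * (Num.max (S k w - 2 * eps) 0 ^+ 2 * X k.+1 w) +
      4 * (Num.max (S k w - gs) 0 * X k.+1 w ^+ 2)).
    by apply: ler_wpM2l; [exact: alive_ge0|apply: h; rewrite kn].
  apply: le_trans (le_trans h _); last by rewrite !mulrDr; lra.
  case: (stepP w kn) => // Sk Sk1 Sk1'.
  have -> : Num.max (S k.+1 w - 2 * eps) 0 = 0 by apply/max_idPr; lra.
  by rewrite expr0n !mulr0.
rewrite !ExD ?ExZ; try by bm_auto.
rewrite e1 e2 mulr0 addr0 t_rec.
have h1 := IH kn'; have h2 := ler_wpM2l (s2_ge0 k.+1) (Ex_excess_le kn'); lra.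
Qed.

Lemma mean_alive_le k : (k <= n)%N -> E (fun w => J k w * S k w) <= En + gs * p k.
Proof.
move=> kn; have bJ := bm_J kn; have bS := bm_S kn.
rewrite -lerBlDr; apply: le_trans (Ex_excess_le kn).
rewrite /p -ExZ// -ExB; try by bm_auto.
apply: Ex_le; try by bm_auto.
move=> w; rewrite [leLHS](_ : _ = J k w * (S k w - gs)); last by ring.
by apply: ler_wpM2l; [exact: alive_ge0|rewrite le_max lexx].
Qed.

(** The mean of [J k * (S k + eps)] is nonincreasing in [k]: a dying walk has [S + eps >= 0], and
    this is what is lost. *)
Lemma overshoot_le k : (k <= n)%N -> En <= E (fun w => J k w * S k w) + eps * p k.
Proof.
move=> kn; have hr := r0; have hgs := gs0.
have step j : (j < n)%N -> E (fun w => J j.+1 w * S j.+1 w) + eps * p j.+1 <=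
    E (fun w => J j w * S j w) + eps * p j.
  move=> jn; have jn' := ltnW jn.
  have bJo : @bm R _ (others n X j.+1) (J j) by apply: bm_J_others; rewrite ltnSn.
  have bJ := bm_J jn'; have bJ' := bm_J jn; have bS := bm_S jn'; have bS' := bm_S jn.
  have bX : bm (X j.+1 : T -> R) by apply: bm_X; rewrite jn.
  have e : E (fun w => J j w * X j.+1 w) = 0 by apply: Ex_mulX => //; rewrite jn.
  rewrite -[leRHS]addr0 -[X in _ <= _ + X]e /p -!ExZ// -!ExD; try by bm_auto.
  apply: Ex_le; try by bm_auto.
  move=> w; have eS := S_rec j w.
  by case: (stepP w jn) => [|h1 h2|h1 h2 h3]; lra.
have mono j : (j <= n)%N -> E (fun w => J n w * S n w) + eps * p n <=
    E (fun w => J j w * S j w) + eps * p j.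
  move=> jn; rewrite -(subKn jn); move: (n - j)%N (leq_subr j n) => i.
  elim: i => [|i IH] ilt; first by rewrite subn0.
  apply: (le_trans (IH (ltnW ilt))).
  have -> : (n - i)%N = (n - i.+1).+1 by rewrite -subSn// subSS.
  by apply: step; rewrite ltn_subrL (leq_ltn_trans _ ilt).
apply: le_trans (mono k kn).
have bJ := bm_J (leqnn n); have bS := bm_S (leqnn n).
rewrite /overshoot /p -ExZ// -ExD; try by bm_auto.
apply: Ex_le; try by bm_auto.
move=> w.
have : `|g n| <= gs by apply: ggs; rewrite n1 leqnn.
rewrite ler_norml => /andP[h _].
have : 0 <= (gs + r + g n) * J n w by rewrite mulr_ge0 ?alive_ge0//; lra.
lra.
Qed.

(** * The heat-equation barrier along the walk *)

Variable K : R.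
Hypothesis K2 : 2 <= K.
Hypothesis gaussK : forall x : R, gauss_fun x * (1 + x ^+ 2) ^+ 4 <= K.
Hypothesis tn1 : t n = 1.
Variable delta : R.
Hypothesis delta_gt0 : 0 < delta.
Hypothesis r_delta : r ^+ 2 <= delta.
Hypothesis delta_le1 : delta <= 1.

Definition scale k := Num.sqrt (2 * (1 - t k + delta)).
Local Notation b := scale.

Lemma t_le j k : (j <= k)%N -> t j <= t k.
Proof.
elim: k => [|k IH]; first by rewrite leqn0 => /eqP ->.
rewrite leq_eqVlt => /predU1P[-> //|]; rewrite ltnS => /IH h.
by rewrite t_rec (le_trans h)// lerDl s2_ge0.
Qed.

Lemma t_ge0 k : 0 <= t k.
Proof. by rewrite (le_trans _ (t_le (leq0n k)))// /t big_geq. Qed.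

Lemma t_le1 k : (k <= n)%N -> t k <= 1.
Proof. by move=> kn; rewrite -tn1 t_le. Qed.

Lemma scale_gt0 k : (k <= n)%N -> 0 < b k.
Proof. by move=> /t_le1 h; rewrite sqrtr_gt0 mulr_gt0//; have := delta_gt0; lra. Qed.

Lemma scale2 k : (k <= n)%N -> b k ^+ 2 = 2 * (1 - t k + delta).
Proof. by move=> /t_le1 h; rewrite sqr_sqrtr// mulr_ge0//; have := delta_gt0; lra. Qed.

Let derivative_measurable (f f' : R -> R) : (forall x : R, is_derive x 1 f (f' x)) ->
  measurable_fun setT f.
Proof.
move=> df; apply: continuous_measurable_fun => x.
apply: differentiable_continuous; apply/derivable1_diffP.
exact: (@ex_derive _ _ _ _ _ _ _ (df x)).
Qed.

Let bm_affine d' (T' : measurableType d') (a y : R) (Y : T' -> R) : bm Y ->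
  bm (fun w => (Y w + y) / a).
Proof.
move=> bY; apply: bmM; last exact: bm_cst.
by apply: bmD => //; exact: bm_cst.
Qed.

Let bm_erf d' (T' : measurableType d') (Y : T' -> R) : bm Y ->
  bm (fun w => erf (Y w)).
Proof.
move=> bY; apply: (@bm_comp _ _ _ (@erf R) _ 1) => //; last exact: normr_erf_le1.
exact: derivative_measurable (@is_derive_erf R).
Qed.

Let bm_erf1 d' (T' : measurableType d') (Y : T' -> R) : bm Y ->
  bm (fun w => erf1 (Y w)).
Proof.
move=> bY; apply: (@bm_comp _ _ _ (@erf1 R) _ (2 * K)) => //.
  exact: derivative_measurable (@is_derive_erf1 R).
have k0 : 0 <= K by apply: le_trans K2.
move=> x; rewrite ger0_norm ?erf1_ge0//.
apply: (le_trans (erf1_decay gaussK x)); rewrite -[leRHS]mulr1.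
apply: ler_wpM2l; first by rewrite mulr_ge0.
by rewrite exprn_ile1 ?lorentz_le1// ltW// lorentz_gt0.
Qed.

Let bm_erf2 d' (T' : measurableType d') (Y : T' -> R) : bm Y ->
  bm (fun w => erf2 (Y w)).
Proof.
move=> bY; apply: (@bm_comp _ _ _ (@erf2 R) _ (4 * K)) => //.
  exact: derivative_measurable (@is_derive_erf2 R).
have k0 : 0 <= K by apply: le_trans K2.
move=> x; rewrite (_ : erf2 x = - 2 * (x * erf1 x)); last by rewrite /erf2; ring.
have h := xerf1_decay K2 gaussK x.
have h2 : 2 * K * lorentz x <= 2 * K * 1 by rewrite ler_wpM2l ?lorentz_le1 ?mulr_ge0.
rewrite normrM normrN normr_nat; lra.
Qed.

(* A walk which dies does so at a position [S] with [`|S| <= eps], where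
   [sg * erf ((S + sg * eps) / b)] is nonnegative: killing can only decrease
   [sg * barrier_mean sg]. *)
Definition barrier_mean (sg : R) k :=
  E (fun w => J k w * erf ((S k w + sg * eps) / b k)).
Local Notation V := barrier_mean.

(** Survival and position are taken at separate times: anticoncentration at time [k] uses the
    increments after [j], while survival may be relaxed to the earlier time. *)
Definition layer (sg : R) j k a :=
  E (fun w => J j w * lorentz ((S k w + sg * eps) / a)).

Lemma barrier_step sg k : sg = 1 \/ sg = -1 -> (k < n)%N ->
  sg * V sg k.+1 <= sg * V sg k +
    96 * K * r * s2 k.+1 / b k.+1 ^+ 3 * layer sg k k (b k.+1).
Proof.
move=> sg1 kn; have kn' := ltnW kn.
have hr := r0; have hgs := gs0; have hd := delta_gt0.
have i1n : (1 <= k.+1 <= n)%N by rewrite kn.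
have bJo : @bm R _ (others n X k.+1) (J k) by apply: bm_J_others; rewrite ltnSn.
have bSo : @bm R _ (others n X k.+1) (S k) by apply: bm_S_others; rewrite ltnSn.
have bJ := bm_J kn'; have bJ' := bm_J kn; have bS := bm_S kn'; have bS' := bm_S kn.
have bX : bm (X k.+1 : T -> R) by apply: bm_X.
set c := sg * eps.
pose z w := (S k w + c) / b k.+1.
have bzo : @bm R _ (others n X k.+1) z by exact: (@bm_affine _ (others n X k.+1)).
have bz : bm z by exact: bm_others bzo.
pose f1 w := J k w * erf1 (z w).
pose f2 w := J k w * erf2 (z w).
pose f3 w := J k w * lorentz (z w).
have bf1o : @bm R _ (others n X k.+1) f1.
  by apply: (@bmM _ _ (others n X k.+1)) => //; exact: (@bm_erf1 _ (others n X k.+1)).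
have bf2o : @bm R _ (others n X k.+1) f2.
  by apply: (@bmM _ _ (others n X k.+1)) => //; exact: (@bm_erf2 _ (others n X k.+1)).
have bf3o : @bm R _ (others n X k.+1) f3.
  by apply: (@bmM _ _ (others n X k.+1)) => //; exact: (@bm_lorentz _ (others n X k.+1)).
have bf1 := bm_others bf1o; have bf2 := bm_others bf2o; have bf3 := bm_others bf3o.
have e1 : E (fun w => f1 w * X k.+1 w) = 0 by exact: Ex_mulX.
have e2 : E (fun w => f2 w * X k.+1 w ^+ 2) = s2 k.+1 * E f2 by exact: Ex_mulX2.
have e3 : E (fun w => f3 w * X k.+1 w ^+ 2) = s2 k.+1 * E f3 by exact: Ex_mulX2.
have bV : bm (fun w => erf ((S k w + c) / b k)) by apply: bm_erf; exact: bm_affine.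
have bV' : bm (fun w => erf ((S k.+1 w + c) / b k.+1)) by apply: bm_erf; exact: bm_affine.
have B0 := scale_gt0 kn; have B0' := scale_gt0 kn'.
set C := 48 * K * r / b k.+1 ^+ 3.
(* A pointwise majorant, expanded so that each product falls under [e1], [e2] or [e3]. The linear
   term averages to 0, the two [f2] terms cancel, and the two [C] terms contribute equally, turning
   48 into 96. *)
pose h w := sg * (J k w * erf ((S k w + c) / b k)) + sg / b k.+1 * (f1 w * X k.+1 w) +
  sg / (2 * b k.+1 ^+ 2) * (f2 w * X k.+1 w ^+ 2) -
  sg / (2 * b k.+1 ^+ 2) * s2 k.+1 * f2 w +
  C * (f3 w * X k.+1 w ^+ 2) + C * s2 k.+1 * f3 w.
have eh : E h = sg * V sg k + 96 * K * r * s2 k.+1 / b k.+1 ^+ 3 * layer sg k k (b k.+1).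
  rewrite /h; rewrite !ExD ?ExN ?ExZ ?e1 ?e2 ?e3; try by bm_auto.
  have -> : layer sg k k (b k.+1) = E f3 by [].
  by rewrite /V -/c /C; field; rewrite gt_eqF.
rewrite -eh /V -ExZ; try by bm_auto.
have heat w : sg * erf ((S k.+1 w + c) / b k.+1) <=
    sg * erf ((S k w + c) / b k) + sg * (erf1 (z w) / b k.+1 * X k.+1 w) +
    sg * (erf2 (z w) / (2 * b k.+1 ^+ 2) * (X k.+1 w ^+ 2 - s2 k.+1)) +
    C * (X k.+1 w ^+ 2 + s2 k.+1) * lorentz (z w).
  have := @erf_heat_step R K K2 gaussK (b k.+1) (b k) (S k w + c) (X k.+1 w) (s2 k.+1) r.
  rewrite !scale2// t_rec; move=> /(_ B0 B0').
  rewrite (_ : S k w + c + X k.+1 w = S k.+1 w + c); last by rewrite S_rec; ring.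
  have d1 : 2 * (1 - t k + delta) = 2 * (1 - (t k + s2 k.+1) + delta) + 2 * s2 k.+1 by ring.
  have d2 := s2_ge0 k.+1; have d3 := s2_le i1n.
  have d4 : 2 * r ^+ 2 <= 2 * (1 - (t k + s2 k.+1) + delta).
    by have := t_le1 kn; rewrite t_rec; have := r_delta; lra.
  move=> /(_ d1 d2 d3 d4 (Xr w i1n)).
  rewrite -/(z w) -/C ler_norml => /andP[m1 m2].
  by case: sg1 => ->; lra.
apply: Ex_le; try by bm_auto.
move=> w; apply: (@le_trans _ _ (J k w * (sg * erf ((S k.+1 w + c) / b k.+1)))).
  case: (stepP w kn) => [|d1 d2|d1 d2 d3]; rewrite ?mul0r ?mulr0 ?mul1r//.
  case: sg1 => sgE; rewrite sgE.
    rewrite mul1r erf_ge0//; apply: divr_ge0; last exact: ltW.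
    by rewrite /c sgE; lra.
  by rewrite mulN1r oppr_ge0 erf_le0// pmulr_lle0 ?invr_gt0// /c sgE; lra.
apply: (le_trans (ler_wpM2l (alive_ge0 k w) (heat w))).
rewrite /h /f1 /f2 /f3 le_eqVlt; apply/orP; left; apply/eqP.
by field; rewrite gt_eqF.
Qed.

Let sg_norm sg : sg = 1 \/ sg = -1 -> - eps <= sg * eps <= eps.
Proof.
have hr := r0; have hgs := gs0.
by case=> ->; apply/andP; split; lra.
Qed.

Lemma layer_le_p sg j k a : (j <= n)%N -> (k <= n)%N -> layer sg j k a <= p j.
Proof.
move=> jn kn; have bJ := bm_J jn; have bS := bm_S kn.
have bL : bm (fun w => lorentz ((S k w + sg * eps) / a)) by exact: bm_lorentz.
apply: Ex_le; try by bm_auto.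
by move=> w; rewrite ler_piMr ?alive_ge0// lorentz_le1.
Qed.

Lemma layer_le sg i j k a : (i <= j)%N -> (j <= n)%N -> (k <= n)%N ->
  layer sg j k a <= layer sg i k a.
Proof.
move=> ij jn kn; have bJ := bm_J jn; have bJi := bm_J (leq_trans ij jn).
have bS := bm_S kn.
have bL : bm (fun w => lorentz ((S k w + sg * eps) / a)) by exact: bm_lorentz.
apply: Ex_le; try by bm_auto.
move=> w; apply: ler_wpM2r; last exact: alive_le_trans.
by rewrite ltW// lorentz_gt0.
Qed.

Lemma layer_anticoncentration sg j l a : (j <= l)%N -> (l <= n)%N ->
  0 < a -> r <= a -> (t l - t j) * layer sg j l a <= 18 * a * p j.
Proof.
move=> jl ln a0 ra; apply: anticoncentration => //.
by have := t_ge0 j; have := t_le1 ln; lra.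
Qed.

(** For the sign 1 a survivor has [S n + eps >= 0], so that [erf_tail] applies; for the sign -1 it
    suffices that [erf] is at most 1. *)
Lemma barrier_end sg : sg = 1 \/ sg = -1 ->
  sg * p n <= sg * V sg n + K * layer sg n n (b n).
Proof.
move=> sg1; have hr := r0; have hgs := gs0.
have bJ := bm_J (leqnn n); have bS := bm_S (leqnn n).
have bL : bm (fun w => lorentz ((S n w + sg * eps) / b n)) by exact: bm_lorentz.
have bV : bm (fun w => erf ((S n w + sg * eps) / b n)).
  by apply: bm_erf; exact: bm_affine.
have k0 : 0 <= K by apply: le_trans K2.
rewrite /p /V /layer -!ExZ; try by bm_auto.
rewrite -ExD; try by bm_auto.
apply: Ex_le; try by bm_auto.
move=> w; set z := _ / b n.
have q0 : 0 <= K * lorentz z by rewrite mulr_ge0// ltW// lorentz_gt0.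
suff h : 0 <= J n w * (sg * erf z - sg + K * lorentz z) by lra.
case: (alive_cases w (leqnn n)) => [->|[-> Sn]]; rewrite ?mul0r ?mul1r//.
case: sg1 => sgE; rewrite sgE.
  have := @erf_tail R K K2 gaussK z; rewrite mul1r => /(_ _) h.
  suff /h : 0 <= z by lra.
  apply: divr_ge0; last by rewrite ltW// scale_gt0.
  by rewrite sgE; lra.
by have := normr_erf_le1 z; rewrite ler_norml => /andP[_ h]; lra.
Qed.

(** On survival [|S m + sg * eps|] is at most [u + v], where [u] is the excess over [2 * eps] and
    [v = 3 * eps]. Then [(u + v) ^ 3 <= 4 * (u ^ 3 + v ^ 3)] gives [16 = 4 * 4] and
    [108 = 4 * 27]. *)
Lemma cubic_moment_shift sg m : sg = 1 \/ sg = -1 -> (m <= n)%N ->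
  E (fun w => J m w * `|S m w + sg * eps| ^+ 3) <=
  16 * t m * En + 108 * eps ^+ 3 * p m.
Proof.
move=> sg1 mn; have hr := r0; have hgs := gs0.
have /andP[sge1 sge2] := sg_norm sg1.
have bJ := bm_J mn; have bS := bm_S mn.
have bc : bm (fun w : T => sg * eps) by exact: bm_cst.
have h := cubic_moment mn.
apply: (@le_trans _ _ (E (fun w => 4 * (J m w * Num.max (S m w - 2 * eps) 0 ^+ 3) +
    108 * eps ^+ 3 * J m w))); last first.
  by rewrite ExD ?ExZ; [rewrite -/(p m)|..]; try by bm_auto; lra.
apply: Ex_le; try by bm_auto.
move=> w.
suff h2 : J m w * `|S m w + sg * eps| ^+ 3 <=
    J m w * (4 * (Num.max (S m w - 2 * eps) 0 ^+ 3 + (3 * eps) ^+ 3)).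
  by apply: (le_trans h2); rewrite le_eqVlt; apply/orP; left; apply/eqP; ring.
case: (alive_cases w mn) => [->|[-> Sm]]; rewrite ?mul0r ?mul1r//.
set u := Num.max _ _; set v := 3 * eps.
have u0 : 0 <= u by rewrite le_max lexx orbT.
have u1 : S m w - 2 * eps <= u by rewrite le_max lexx.
have v0 : 0 <= v by rewrite /v; lra.
apply: (@le_trans _ _ ((u + v) ^+ 3)).
  rewrite lerXn2r ?nnegrE ?addr_ge0// ler_norml /v; apply/andP; split; lra.
have : 0 <= (u + v) * (u - v) ^+ 2 by rewrite mulr_ge0 ?sqr_ge0 ?addr_ge0.
lra.
Qed.

Definition shifted_mean (sg : R) m := E (fun w => J m w * (S m w + sg * eps)).
Local Notation M := shifted_mean.

Lemma barrier_start sg m : sg = 1 \/ sg = -1 -> (m <= n)%N ->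
  `|V sg m - 2 / Num.sqrt pi / b m * M sg m| <=
  8 * K / b m ^+ 3 * (16 * t m * En + 108 * eps ^+ 3 * p m).
Proof.
move=> sg1 mn.
have bJ := bm_J mn; have bS := bm_S mn; have B0 := scale_gt0 mn.
have k0 : 0 <= K by apply: le_trans K2.
have bc : bm (fun w : T => sg * eps) by exact: bm_cst.
have bV : bm (fun w => erf ((S m w + sg * eps) / b m)).
  by apply: bm_erf; exact: bm_affine.
apply: (@le_trans _ _ (8 * K / b m ^+ 3 * E (fun w => J m w * `|S m w + sg * eps| ^+ 3))).
  rewrite /V /M -!ExZ -?ExB; try by bm_auto.
  apply: (le_trans (le_normr_Rintegral _ _)) => //.
    by apply: bm_integrable; bm_auto.
  apply: Ex_le; try by bm_auto.
  move=> w; set x := S m w + sg * eps.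
  rewrite (_ : _ - _ = J m w * (erf (x / b m) - 2 / Num.sqrt pi * (x / b m))); last first.
    by ring.
  rewrite normrM (ger0_norm (alive_ge0 _ _)) [leRHS]mulrCA.
  apply: ler_wpM2l; first exact: alive_ge0.
  apply: (le_trans (erf_near0 K2 gaussK (x / b m))).
  rewrite normrM normfV (gtr0_norm B0) exprMn exprVn.
  by rewrite le_eqVlt; apply/orP; left; apply/eqP; ring.
apply: ler_wpM2l; last exact: cubic_moment_shift.
by apply: divr_ge0; [rewrite mulr_ge0|rewrite exprn_ge0// ltW].
Qed.

Lemma mean_alive_shift_le sg m : sg = 1 \/ sg = -1 -> (m <= n)%N ->
  `|M sg m - En| <= 2 * eps * p m.
Proof.
move=> sg1 mn; have hr := r0; have hgs := gs0.
have bJ := bm_J mn; have bS := bm_S mn.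
have bc : bm (fun w : T => sg * eps) by exact: bm_cst.
have -> : M sg m = E (fun w => J m w * S m w) + sg * eps * p m.
  rewrite /M /p -ExZ// -ExD; try by bm_auto.
  by congr Ex; apply/funext => w; ring.
have h1 := mean_alive_le mn; have h2 := overshoot_le mn; have p0 := p_ge0 m.
have h3 : 0 <= r * p m by rewrite mulr_ge0.
have h4 : 0 <= gs * p m by rewrite mulr_ge0.
by rewrite ler_norml; apply/andP; case: sg1 => ->; split; lra.
Qed.

Lemma survival_asymptotics kappa : 0 < kappa -> kappa <= 24^-1 ->
  eps = kappa ^+ 3 -> delta = kappa ^+ 4 ->
  `|p n - Num.sqrt (2 / pi) * En| <=
  (K * (38 * 24 + 96 * 38 * 96 + 96 * 4 + 8 * (32 + 108 * 4)) + 24) *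
    (kappa ^+ 2 * En).
Proof.
move=> k0 k1 ek dk.
apply: (@asymptotics_from_estimates R n r gs K delta p t s2 b V layer M En r0 gs0 K2
  delta_gt0 r_delta delta_le1 tn1 _ t_rec s2_ge0 s2_le p_ge0 p_le t_ge0 t_le1
  scale_gt0 scale2 overshoot_ge0 p_le_overshoot barrier_step layer_le_p layer_le
  layer_anticoncentration barrier_end barrier_start mean_alive_shift_le
  kappa k0 k1 ek dk).
by rewrite /t big_geq.
Qed.

(** With total variance 1 this excludes [r = 0]. *)
Lemma sq_sum_le : t n <= n%:R * r ^+ 2.
Proof.
rewrite /t mulr_natl -[X in _ *+ X](subn1 n.+1) -sumr_const_nat.
by apply: ler_sum_nat => i; rewrite ltnS; exact: s2_le.
Qed.

End walk.

(* The first summand comes from [survival_asymptotics], where [sqrt (2 / pi)] is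
   at least [1 / 2]; the second one makes the bounds trivial for
   [eps > 24 ^- 3]. *)
Definition row_constant (R : realType) (K : R) : R :=
  2 * (K * (38 * 24 + 96 * 38 * 96 + 96 * 4 + 8 * (32 + 108 * 4)) + 24) +
  8 * 24 ^+ 2.

(** * The three bounds for a row whose entries are bounded everywhere *)

Section bounded_row.
Context (R : realType) (d : measure_display) (T : measurableType d).
Variables (P : probability T R) (n : nat) (X : nat -> {RV P >-> R}).
Variables (g : nat -> R) (r gs K : R).
Hypothesis indX : independent_rvs [set i : nat | (1 <= i <= n)%N] X.
Hypothesis Xr : forall i w, (1 <= i <= n)%N -> `|X i w| <= r.
Hypothesis EX0 : forall i, (1 <= i <= n)%N -> Ex P (X i) = 0.
Hypothesis ggs : forall k, (1 <= k <= n)%N -> `|g k| <= gs.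
Hypothesis n1 : (1 <= n)%N.
Hypothesis tn1 : elapsed_variance X n = 1.
Hypothesis pn_gt0 : 0 < alive_prob X g n.
Hypothesis K2 : 2 <= K.
Hypothesis gaussK : forall x : R, gauss_fun x * (1 + x ^+ 2) ^+ 4 <= K.

Local Notation eps := (r + gs).
Local Notation En := (overshoot n X g).
Local Notation c := (Num.sqrt (2 / pi) : R).

Let r0 : 0 <= r.
Proof. by apply: le_trans (Xr point (_ : (1 <= 1 <= n)%N)); rewrite ?normr_ge0. Qed.

Let gs0 : 0 <= gs.
Proof. by apply: le_trans (@ggs 1 _); rewrite ?normr_ge0. Qed.

Let r_gt0 : 0 < r.
Proof.
rewrite lt_def r0 andbT; apply/eqP => re0.
by have := sq_sum_le Xr r0; rewrite tn1 re0 expr0n /= mulr0 ler10.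
Qed.

Lemma row_overshoot_ge0 : 0 <= En.
Proof. exact: (overshoot_ge0 indX Xr EX0 ggs gs0 n1). Qed.

Lemma row_late_survival m : (m <= n)%N -> 24 * eps <= Num.sqrt (elapsed_variance X m) ->
  alive_prob X g m * Num.sqrt (elapsed_variance X m) <= 4 * En.
Proof.
move=> mn h; have h0 : 0 < Num.sqrt (elapsed_variance X m).
  by apply: lt_le_trans h; rewrite mulr_gt0// ltr_pwDl.
apply: (p_le_overshoot indX Xr EX0 ggs r0 gs0 pn_gt0 n1) => //.
by rewrite sqr_sqrtr// t_ge0.
Qed.

Let c_ge : 2^-1 <= c.
Proof.
have p0 : 0 < pi :> R := pi_gt0 R.
have p4 : pi < 4 :> R by have := @pihalf_lt2 R; rewrite ltr_pdivrMr//; lra.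
rewrite -(@ler_pXn2r _ 2)// ?nnegrE ?sqrtr_ge0// sqr_sqrtr ?divr_ge0 ?(ltW p0)//.
rewrite ler_pdivlMr//; lra.
Qed.

Let kappa := eps `^ 3^-1.

Let kappa3 : eps = kappa ^+ 3.
Proof.
by rewrite /kappa -powR_mulrn ?powR_ge0// -powRrM mulVf// powRr1// addr_ge0.
Qed.

Let kappa2 : kappa ^+ 2 = eps `^ (2 / 3).
Proof. by rewrite /kappa -powR_mulrn ?powR_ge0// -powRrM mulrC. Qed.

Let kappa_gt0 : 0 < kappa.
Proof. by rewrite powR_gt0// ltr_pwDl. Qed.

Let asymptotics : kappa <= 24^-1 ->
  `|alive_prob X g n - c * En| <= row_constant K * (kappa ^+ 2 * (c * En)).
Proof.
move=> k1; have hk := kappa_gt0; have hE := row_overshoot_ge0.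
have kle1 : kappa <= 1 by lra.
have d0 : 0 < kappa ^+ 4 by rewrite exprn_gt0.
have d1 : kappa ^+ 4 <= 1 by rewrite exprn_ile1// ltW.
have rd : r ^+ 2 <= kappa ^+ 4.
  have rk : r <= kappa ^+ 2.
    have : kappa ^+ 3 <= kappa ^+ 2 by rewrite exprS ler_piMl// exprn_ge0// ltW.
    by rewrite -kappa3; have := gs0; lra.
  by rewrite (exprM _ 2 2) lerXn2r ?nnegrE// exprn_ge0// ltW.
have := @survival_asymptotics R d T P n X g r gs indX Xr EX0 ggs r0 gs0 pn_gt0 n1
  K K2 gaussK tn1 (kappa ^+ 4) d0 rd d1 kappa hk k1 kappa3 erefl.
set C0 := _ + 24 => h; apply: (le_trans h).
have C00 : 0 <= C0 by rewrite addr_ge0// mulr_ge0//; have := K2; lra.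
have kE : 0 <= kappa ^+ 2 * En by rewrite mulr_ge0// exprn_ge0// ltW.
apply: (@le_trans _ _ (C0 * (2 * c * (kappa ^+ 2 * En)))).
  by apply: ler_wpM2l => //; rewrite ler_peMl//; have := c_ge; lra.
rewrite /row_constant -/C0 (_ : C0 * _ = 2 * C0 * (kappa ^+ 2 * (c * En))); last by ring.
apply: ler_wpM2r; last by rewrite lerDl mulr_ge0// sqr_ge0.
by apply: mulr_ge0; [exact: sqr_ge0|rewrite mulr_ge0// sqrtr_ge0].
Qed.

Let large_kappa : 24^-1 < kappa -> 8 <= row_constant K * kappa ^+ 2.
Proof.
move=> k1.
have h1 : 8 * 24 ^+ 2 <= row_constant K.
  by rewrite /row_constant lerDr mulr_ge0// addr_ge0// mulr_ge0//; have := K2; lra.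
have h2 : 24^-1 ^+ 2 <= kappa ^+ 2 by rewrite lerXn2r ?nnegrE// ltW.
apply: le_trans (ler_pM _ _ h1 h2); rewrite ?mulr_ge0//.
by rewrite -mulrA -exprMn divff// expr1n mulr1.
Qed.

Lemma row_lower : c * En * (1 - row_constant K * eps `^ (2 / 3)) <= alive_prob X g n.
Proof.
have hE := row_overshoot_ge0; rewrite -kappa2.
have cE : 0 <= c * En by rewrite mulr_ge0// sqrtr_ge0.
have [k1|/large_kappa k1] := leP kappa 24^-1.
  by have := asymptotics k1; rewrite ler_norml => /andP[h _]; lra.
(* For large [kappa] the factor [1 - row_constant K * kappa ^ 2] is negative, so the lower bound is
   at most 0. *)
apply: le_trans (ltW pn_gt0).
by rewrite mulr_ge0_le0//; lra.
Qed.

Lemma row_upper : eps <= 24^-1 ->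
  alive_prob X g n <= c * En * (1 + row_constant K * eps `^ (2 / 3)).
Proof.
move=> e24; have hE := row_overshoot_ge0; rewrite -kappa2.
have cE : 0 <= c * En by rewrite mulr_ge0// sqrtr_ge0.
have [k1|/large_kappa k1] := leP kappa 24^-1.
  by have := asymptotics k1; rewrite ler_norml => /andP[_ h]; lra.
(* For large [kappa] the third bound at [m = n] gives [p n <= 4 * En], which is at most [8 * c * En]
   because [c >= 1 / 2]. *)
have := @row_late_survival n (leqnn n); rewrite tn1 sqrtr1 mulr1 => h.
apply: (le_trans (h _)); first by lra.
have h1 := ler_wpM2r hE c_ge.
have h2 := ler_wpM2l cE k1.
lra.
Qed.

End bounded_row.

(** * From almost sure bounds to everywhere bounds, and back to the stated quantities *)

Section truncation.
Context (R : realType) (d : measure_display) (T : measurableType d).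
Variables (P : probability T R).
Implicit Types (X : nat -> {RV P >-> R}) (g : nat -> R).

Lemma aliveE X g m w : alive X g m w =
  (all (fun k => g k < partial_sum (fun i => X i : T -> R) k w) (iota 1 m))%:R.
Proof.
elim: m => [//|m IH].
have iotaS : iota 1 m.+1 = rcons (iota 1 m) m.+1 by rewrite -[in LHS](addn1 m) iotaD cats1 add1n.
by rewrite [LHS]/= IH iotaS all_rcons andbC -mulnb natrM.
Qed.

(** Crossing times are integers, so a walk alive at time [m] has crossing time at least [m + 1], or
    [+oo] if the boundary is never crossed. The condition [m <= n] keeps every crossing up to [m]
    within the range of the infimum. *)
Lemma aliveE_survival X g n m w : (m <= n)%N ->
  alive X g m w = \1_(survival (fun i => X i : T -> R) g n m) w.
Proof.
move=> mn; rewrite aliveE indicE; congr (nat_of_bool _)%:R.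
apply/idP/idP => [/allP h|].
  rewrite inE /survival /= /crossing_time.
  apply: (@lt_le_trans _ _ (m.+1%:R)%:E); first by rewrite lte_fin ltr_nat.
  apply: le_ereal_inf_tmp => _ [k [/andP[k1 kn] Sk] <-]; rewrite lee_fin ler_nat.
  rewrite ltnNge; apply/negP => km.
  by have := h k; rewrite mem_iota k1 add1n ltnS km => /(_ isT); rewrite ltNge Sk.
rewrite inE /survival /= /crossing_time => h; apply/allP => k.
rewrite mem_iota add1n ltnS => /andP[k1 km]; rewrite ltNge; apply/negP => Sk.
move: h; rewrite ltNge => /negP; apply.
apply: (@le_trans _ _ (k%:R)%:E); last by rewrite lee_fin ler_nat.
by apply: ereal_inf_lbound; exists k => //=; rewrite k1 (leq_trans km).
Qed.

Lemma measurable_partial_sum X k :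
  measurable_fun setT (partial_sum (fun i => X i : T -> R) k).
Proof. by apply: measurable_sum => i; exact: measurable_funP. Qed.

Lemma measurable_alive X g m : measurable_fun setT (alive X g m).
Proof.
elim: m => [|m IH]; first exact: measurable_cst.
apply: measurable_funM => //.
apply: (@measurableT_comp _ _ _ _ _ _ (fun x => ((g m.+1 < x)%R%:R : R))).
  apply: nondecreasing_measurable => // x y xy.
  by case: ltP => cx; [rewrite (lt_le_trans cx xy)|rewrite ler0n].
exact: measurable_partial_sum.
Qed.

Lemma ae_expectation (f h : T -> R) : measurable_fun setT f -> bm h ->
  (\forall w \ae P, f w = h w) -> 'E_P[f]%E = (Ex P h)%:E.
Proof.
move=> mf bh fh; rewrite -expectationE// unlock.
apply: ae_eq_integral => //; [exact/measurable_EFinP| |].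
  by apply/measurable_EFinP; case: bh.
by apply: filterS fh => w -> _.
Qed.

Variables (n : nat) (X : nat -> {RV P >-> R}) (g : nat -> R) (r : R).
Hypothesis indX : independent_rvs [set i : nat | (1 <= i <= n)%N] X.
Hypothesis EX0 : forall i, (1 <= i <= n)%N -> ('E_P[X i] = 0)%E.
Hypothesis n1 : (1 <= n)%N.
Hypothesis VX1 : sum_sq_moments P (fun i => X i : T -> R) n = 1%E.
Hypothesis Xr : forall i, (1 <= i <= n)%N -> \forall w \ae P, `|X i w| <= r.
Hypothesis Psurv : (0 < P (survival (fun i => X i : T -> R) g n n))%E.

(** Clamping enforces the bound at every point while changing each entry on a null set only. As it
    acts entrywise by a measurable function, independence survives. *)
Let clamp (x : R) := Num.max (- r) (Num.min r x).

Let clamp_nd : {homo clamp : x y / x <= y}.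
Proof.
by move=> x y xy; rewrite /clamp /Order.max /Order.min; do !case: ifP; lra.
Qed.

Let measurable_clamp i : measurable_fun setT (fun w => clamp (X i w)).
Proof.
apply: measurableT_comp; last exact: measurable_funP.
exact: nondecreasing_measurable.
Qed.

Let Y i : {RV P >-> R} := HB.pack (fun w => clamp (X i w))
  (isMeasurableFun.Build _ _ _ _ _ (@measurable_clamp i)).

Let r0 : 0 <= r.
Proof.
have PT : (0 < P setT)%E by rewrite probability_setT.
have [|w h] := @filter_ex _ _ (ae_properfilter_algebraOfSetsType PT) _ (@Xr 1 _).
  by rewrite n1.
exact: le_trans h.
Qed.

Let Yr i w : (1 <= i <= n)%N -> `|Y i w| <= r.
Proof.
move=> _; rewrite /Y /= /clamp ler_norml.
rewrite le_max lexx /= ge_max ge_min lexx /= andbT.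
by have := r0; lra.
Qed.

Let XY : \forall w \ae P, forall i, (1 <= i <= n)%N -> X i w = Y i w.
Proof.
have : \forall w \ae P, forall i, (1 <= i <= n)%N -> `|X i w| <= r.
  apply: ae_foralln => i; have [i1n|i1n] := boolP (1 <= i <= n)%N.
    by apply: filterS (Xr i1n) => w.
  by apply: aeW => w.
apply: filterS => w h i /h; rewrite ler_norml => /andP[h1 h2].
by rewrite /Y /= /clamp min_r// max_r.
Qed.

Let indY : independent_rvs [set i : nat | (1 <= i <= n)%N] Y.
Proof.
move=> J A JD mA.
apply: (@indX J (fun i => clamp @^-1` A i) JD) => i iJ.
rewrite -[_ @^-1` _]setTI.
by apply: nondecreasing_measurable => //; exact: mA.
Qed.

Let bY i : (1 <= i <= n)%N -> bm (Y i : T -> R).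
Proof. by move=> i1n; split=> //; exists r => w; exact: Yr. Qed.

Let EY0 i : (1 <= i <= n)%N -> Ex P (Y i) = 0.
Proof.
move=> i1n; apply: EFin_inj; rewrite -(@ae_expectation (X i))//.
- exact: EX0.
- exact: bY.
- by apply: filterS XY => w; exact.
Qed.

Let s2Y i : (1 <= i <= n)%N -> 'E_P[fun w => (X i w ^+ 2)%R]%E = (step_variance Y i)%:E.
Proof.
move=> i1n; apply: ae_expectation.
- by apply: measurable_funX; exact: measurable_funP.
- by apply: bmX; exact: bY.
- by apply: filterS XY => w ->.
Qed.

Let sum_sqE m : (m <= n)%N ->
  sum_sq_moments P (fun i => X i : T -> R) m = (elapsed_variance Y m)%:E.
Proof.
move=> mn; rewrite /sum_sq_moments /elapsed_variance -sumEFin big_nat [RHS]big_nat.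
by apply: eq_bigr => i /andP[i1 im]; rewrite s2Y// i1; exact: leq_trans mn.
Qed.

Let partial_sumE w k : (forall i, (1 <= i <= n)%N -> X i w = Y i w) -> (k <= n)%N ->
  partial_sum (fun i => X i : T -> R) k w = partial_sum (fun i => Y i : T -> R) k w.
Proof.
move=> XYw kn; apply: eq_big_nat => i /andP[i1 ik].
by rewrite XYw// i1; exact: leq_trans kn.
Qed.

Let aliveEY w k : (forall i, (1 <= i <= n)%N -> X i w = Y i w) -> (k <= n)%N ->
  alive X g k w = alive Y g k w.
Proof.
move=> XYw; elim: k => [//|k IH] kn.
by rewrite /= IH 1?ltnW// partial_sumE.
Qed.

Let gs := bound_max g n.

Let ggs k : (1 <= k <= n)%N -> `|g k| <= gs.
Proof.
move=> /andP[k1 kn]; rewrite /gs /bound_max.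
by apply: (le_bigmax_seq _ k xpredT (fun k => `|g k|)) => //; rewrite mem_index_iota k1 ltnS.
Qed.

Let P_survivalE m : (m <= n)%N ->
  P (survival (fun i => X i : T -> R) g n m) = (alive_prob Y g m)%:E.
Proof.
move=> mn.
have sE : (\1_(survival (fun i => X i : T -> R) g n m) : T -> R) = alive X g m.
  by apply/funext => w; rewrite (aliveE_survival _ _ _ mn).
have ms : measurable (survival (fun i => X i : T -> R) g n m).
  rewrite (_ : survival _ _ _ _ = alive X g m @^-1` [set 1]).
    by rewrite -[_ @^-1` _]setTI; exact: measurable_alive.
  apply/seteqP; split=> w; rewrite /= (aliveE_survival _ _ _ mn) indicE.
    by move=> h; rewrite mem_set.
  case: (boolP (w \in _)) => [|_ /eqP]; first by rewrite inE.
  by rewrite eq_sym oner_eq0.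
rewrite -expectation_indic// sE; apply: ae_expectation.
- exact: measurable_alive.
- exact: (bm_J _ Yr).
- by apply: filterS XY => w /aliveEY; exact.
Qed.

Let overshootE : mean_overshoot P (fun i => X i : T -> R) g n = (overshoot n Y g)%:E.
Proof.
rewrite /mean_overshoot /expectation_on; apply: ae_expectation.
- apply: measurable_funM.
    by apply: measurable_funB => //; exact: measurable_partial_sum.
  rewrite (_ : \1__ = alive X g n); first exact: measurable_alive.
  by apply/funext => w; rewrite (aliveE_survival _ _ _ (leqnn n)).
- apply: bmM; last exact: (bm_J _ Yr).
  by apply: bmB; [exact: (bm_S Yr (leqnn n))|exact: bm_cst].
- apply: filterS XY => w XYw.
  by rewrite -(aliveE_survival X g w (leqnn n)) partial_sumE// aliveEY.
Qed.

Variable K : R.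
Hypothesis K2 : 2 <= K.
Hypothesis gaussK : forall x : R, gauss_fun x * (1 + x ^+ 2) ^+ 4 <= K.

Lemma row_bounds :
  let E := mean_overshoot P (fun i => X i : T -> R) g n in
  let eps := r + bound_max g n in
  let B := std_dev P (fun i => X i : T -> R) in
  [/\ ((Num.sqrt (2 / pi))%:E * E * (1 - row_constant K * eps `^ (2 / 3))%:E
         <= P (survival (fun i => X i : T -> R) g n n))%E,
      eps <= 1 / 24 ->
        (P (survival (fun i => X i : T -> R) g n n)
         <= (Num.sqrt (2 / pi))%:E * E * (1 + row_constant K * eps `^ (2 / 3))%:E)%E
    & forall m, (1 <= m <= n)%N -> 24 * eps <= B m ->
        (P (survival (fun i => X i : T -> R) g n m) <= 4%:E * E / (B m)%:E)%E].
Proof.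
have tn1 : elapsed_variance Y n = 1 by apply: EFin_inj; rewrite -sum_sqE.
have pn0 : 0 < alive_prob Y g n by move: Psurv; rewrite P_survivalE// lte_fin.
move=> E eps B; rewrite /E overshootE P_survivalE// -!EFinM; split.
- rewrite lee_fin; exact: (row_lower indY Yr EY0 ggs n1 tn1 pn0 K2 gaussK).
- rewrite div1r => e24; rewrite lee_fin.
  exact: (row_upper indY Yr EY0 ggs n1 tn1 pn0 K2 gaussK).
- move=> m /andP[m1 mn]; rewrite /B /std_dev sum_sqE//= => hB.
  have h := row_late_survival indY Yr EY0 ggs n1 tn1 pn0 mn hB.
  (* Dividing by [B m] in the extended reals requires [B m > 0], which follows from
     [24 * eps <= B m] once [r > 0]. *)
  have r1 : r != 0.
    apply/eqP => r00; have := sq_sum_le Yr r0.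
    by rewrite tn1 r00 expr0n /= mulr0 ler10.
  have s0 : 0 < Num.sqrt (elapsed_variance Y m).
    apply: lt_le_trans hB; rewrite mulr_gt0// ltr_pwDl ?lt_def ?r1 ?r0//.
    by apply: le_trans (@ggs 1 _); rewrite ?n1.
  by rewrite P_survivalE// inver (gt_eqF s0) -EFinM lee_fin ler_pdivlMr.
Qed.

End truncation.

Theorem theorem1 (R : realType) :
  exists C1 C2 : R,
  forall (d : nat -> measure_display)
    (Omega : forall n : nat, measurableType (d n))
    (P : forall n : nat, probability (Omega n) R)
    (X : forall n : nat, nat -> {RV (P n) >-> R})
    (g : nat -> nat -> R) (r : nat -> R),
  (forall n, (1 <= n)%N ->
     independent_rvs [set i : nat | (1 <= i <= n)%N] (X n)) ->
  (forall n i, (1 <= i <= n)%N -> ('E_(P n)[X n i] = 0)%E) ->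
  (forall n, (1 <= n)%N -> sum_sq_moments (P n) (X n) n = 1%E) ->
  (forall n i, (1 <= i <= n)%N -> \forall w \ae P n, `|X n i w| <= r n) ->
  r n @[n --> \oo] --> 0 ->
  bound_max (g n) n @[n --> \oo] --> 0 ->
  (forall n, (1 <= n)%N -> (0 < P n (survival (X n) (g n) n n))%E) ->
  forall n, (1 <= n)%N ->
  let E := mean_overshoot (P n) (X n) (g n) n in
  let eps := r n + bound_max (g n) n in
  let B := std_dev (P n) (X n) in
  [/\ ((Num.sqrt (2 / pi))%:E * E * (1 - C1 * eps `^ (2 / 3))%:E
         <= P n (survival (X n) (g n) n n))%E,
      eps <= 1 / 24 ->
        (P n (survival (X n) (g n) n n)
         <= (Num.sqrt (2 / pi))%:E * E * (1 + C2 * eps `^ (2 / 3))%:E)%E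
    & forall m, (1 <= m <= n)%N -> 24 * eps <= B m ->
        (P n (survival (X n) (g n) n m) <= 4%:E * E / (B m)%:E)%E].
Proof.
have [K K2 gaussK] := @gauss_decay R.
exists (row_constant K), (row_constant K).
move=> d Omega P X g r indX EX0 VX1 Xr _ _ Psurv n n1.
exact: (row_bounds (indX n n1) (EX0 n) n1 (VX1 n n1) (Xr n) (Psurv n n1) K2 gaussK).
Qed.
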